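(* Let $\alpha\in(1,2)$ and $u\in C^1([0,T])\cap C^2((0,T])$. Then, for $t\in(0,T]$, $$\mathcal{D}_t^{\alpha}u(t)=\mathcal{D}_t^{\frac{\alpha}{2}}\left(\mathcal{D}_t^{\frac{\alpha}{2}}u(t)\right)-u'(0)\,\omega_{2-\alpha}(t).$$ Moreover, if we take $\mathbf{u}(t):=u(t)-t\,u'(0)$, then $$\mathcal{D}_t^{\alpha}u(t)=\mathcal{D}_t^{\alpha}\mathbf{u}(t)=\mathcal{D}_t^{\frac{\alpha}{2}}\left(\mathcal{D}_t^{\frac{\alpha}{2}}\mathbf{u}(t)\right).$$
   Context: $T>0$ is a fixed final time. For $\beta>0$ let $\omega_\beta(t)=\frac{t^{\beta-1}}{\Gamma(\beta)}$. The Riemann–Liouville fractional integral of order $\beta$ is $\mathcal{I}^\beta g(t):=\int_0^t\omega_\beta(t-s)g(s)\,\mathrm{d}s$. For $n-1<\delta<n$ ($n$ a positive integer), the Caputo derivative of order $\delta$ is $\mathcal{D}_t^{\delta}g(t):=(\mathcal{I}^{n-\delta}g^{(n)})(t)$ for $t>0$. In particular, for $1<\alpha<2$, $\mathcal{D}_t^{\alpha}g=\mathcal{I}^{2-\alpha}g''$ and $\mathcal{D}_t^{\alpha/2}g=\mathcal{I}^{1-\alpha/2}g'$. The expression $\mathcal{D}_t^{\alpha/2}(\mathcal{D}_t^{\alpha/2}u(t))$ means the Caputo derivative of order $\alpha/2$ of the function $t\mapsto\mathcal{D}_t^{\alpha/2}u(t)$. *)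

(* Defs.v *)
From Stdlib Require Import Reals Lra.
From Coquelicot Require Import Coquelicot.
Open Scope R_scope.

(* [C_class k D f]: f is k times continuously differentiable on D.  All limits
   are taken within D, so derivatives at endpoints belonging to D are one-sided
   and the values of f outside D play no role. *)
Fixpoint C_class (k : nat) (D : R -> Prop) (f : R -> R) : Prop :=
  match k with
  | O => forall x, D x -> continue_in f D x
  | S k' => exists f' : R -> R,
      (forall x, D x -> D_in f f' D x) /\ C_class k' D f'
  end.

(* Only meaningful for b > 0. *)
Definition Gamma (b : R) : R :=
  RInt_gen (fun x => Rpower x (b - 1) * exp (- x))
    (at_right 0) (Rbar_locally p_infty).

Definition omega (b t : R) : R := Rpower t (b - 1) / Gamma b.

(* The integral over (0, t) is improper at both ends: the kernel is singular at
   s = t when b < 1, and g = u'' may be unbounded (even not absolutely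
   integrable) near s = 0 when u is only C^1 up to 0. *)
Definition is_RL_integral (b : R) (g : R -> R) (t l : R) : Prop :=
  is_RInt_gen (fun s => omega b (t - s) * g s) (at_right 0) (at_left t) l.

Definition RL_integral (b : R) (g : R -> R) (t : R) : R :=
  RInt_gen (fun s => omega b (t - s) * g s) (at_right 0) (at_left t).

(* The integer n with n - 1 < d < n, for d > 0 not an integer. *)
Definition caputo_order (d : R) : nat := Z.to_nat (up d).

Definition Caputo (d : R) (g : R -> R) (t : R) : R :=
  let n := caputo_order d in RL_integral (INR n - d) (Derive_n g n) t.

(* [Caputo] is total; this says that its value at t is a genuine one.  Since
   the integral only involves g^(n) on the open interval (0, t), two-sided
   derivatives suffice even when t is the right end of the domain of g. *)
Definition ex_Caputo (d : R) (g : R -> R) (t : R) : Prop :=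
  let n := caputo_order d in
  (forall (k : nat) (s : R), (k <= n)%nat -> 0 < s < t -> ex_derive_n g k s) /\
  exists l : R, is_RL_integral (INR n - d) (Derive_n g n) t l.

(* Main.v *)
(* The substitution z = (t - s)^b removes the kernel singularity of the
   fractional integral: b Gamma(b) I^b h (t) is the proper integral of
   h (t - z^(1/b)) over [0, t^b].  For h continuous on R and C^1 on (0, +oo)
   this gives (I^b h)' = I^b h' + h(0) omega_b, where I^b h' may converge only
   conditionally at 0.

   The semigroup law I^b I^b = I^(2b) comes from the integral M_G(r) of
   G (y^(1/b) + z^(1/b)) over {y^(1/b) + z^(1/b) <= r}.  An increment of M_G is
   an integral over a thin shell on which the integrand is nearly constant, so
   M_G(r) = V1 * (integral of G (z^(1/(2b))) over [0, r^(2b)]), with V1 the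
   volume at r = 1.  Taking G(s) = g(t - s) gives the semigroup law up to the
   constant V1, and taking G(s) = exp(-s), r -> +oo, identifies
   V1 = (b Gamma(b))^2 / (2b Gamma(2b)).

   With b = 1 - alpha/2 and v = I^b u' one gets
   I^b v' = (I^b v)' = (I^(2b) u')' = I^(2b) u'' + u'(0) omega_(2b). *)
Require Import Defs.
From Stdlib Require Import Reals Lra Lia ZArith.
From Coquelicot Require Import Coquelicot.
Open Scope R_scope.

(** * Real powers extended by zero, and continuity of integrals with a parameter *)

(* Stdlib has Rpower x p = exp (p * ln x) with ln x = 0 for x <= 0, hence the
   junk value Rpower 0 p = 1. *)
Definition ppow (p x : R) : R := if Rlt_dec 0 x then Rpower x p else 0.

Lemma ppow_Rpower p x : 0 < x -> ppow p x = Rpower x p.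
Proof. unfold ppow; destruct (Rlt_dec 0 x); lra. Qed.

Lemma ppow_nonpos p x : x <= 0 -> ppow p x = 0.
Proof. unfold ppow; destruct (Rlt_dec 0 x); lra. Qed.

Lemma ppow_ge0 p x : 0 <= ppow p x.
Proof.
unfold ppow; destruct (Rlt_dec 0 x); [|lra].
apply Rlt_le, exp_pos.
Qed.

Lemma ppow_gt0 p x : 0 < x -> 0 < ppow p x.
Proof. intro; rewrite ppow_Rpower by easy; apply exp_pos. Qed.

Lemma ppow_le p x y : 0 <= p -> x <= y -> ppow p x <= ppow p y.
Proof.
intros Hp Hxy.
destruct (Rle_lt_dec x 0) as [H|H].
- rewrite (ppow_nonpos p x) by lra; apply ppow_ge0.
- rewrite !ppow_Rpower by lra. apply Rle_Rpower_l; lra.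
Qed.

Lemma ppow_ppow_inv p q x : p * q = 1 -> 0 <= x -> ppow p (ppow q x) = x.
Proof.
intros Hpq Hx.
destruct (Req_dec x 0) as [->|H].
- rewrite (ppow_nonpos q 0) by lra; apply ppow_nonpos; lra.
- assert (0 < x) by lra.
  rewrite (ppow_Rpower q) by lra.
  rewrite ppow_Rpower by apply exp_pos.
  rewrite Rpower_mult, (Rmult_comm q p), Hpq. now apply Rpower_1.
Qed.

Lemma ppow_inv_r b x : 0 < b -> 0 <= x -> ppow b (ppow (/ b) x) = x.
Proof. intros Hb Hx. apply ppow_ppow_inv; [field; lra|easy]. Qed.

Lemma ppow_inv_l b x : 0 < b -> 0 <= x -> ppow (/ b) (ppow b x) = x.
Proof. intros Hb Hx. apply ppow_ppow_inv; [field; lra|easy]. Qed.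

Lemma ppow_mult p a x : 0 <= a -> ppow p (a * x) = ppow p a * ppow p x.
Proof.
intros Ha.
destruct (Req_dec a 0) as [->|H].
- rewrite Rmult_0_l, (ppow_nonpos p 0) by lra. ring.
- destruct (Rle_lt_dec x 0) as [Hx|Hx].
  + rewrite (ppow_nonpos p x), (ppow_nonpos p (a * x)); try nra.
  + rewrite !ppow_Rpower by nra. now rewrite Rpower_mult_distr by lra.
Qed.

Lemma ppow_1 p : ppow p 1 = 1.
Proof. rewrite ppow_Rpower by lra. unfold Rpower. now rewrite ln_1, Rmult_0_r, exp_0. Qed.

Lemma ppow_plus p q x : ppow (p + q) x = ppow p x * ppow q x.
Proof.
destruct (Rle_lt_dec x 0) as [Hx|Hx].
- rewrite !ppow_nonpos by lra; ring.
- rewrite !ppow_Rpower by lra. now rewrite Rpower_plus.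
Qed.

Lemma is_derive_ppow p x : 0 < x -> is_derive (ppow p) x (p * Rpower x (p - 1)).
Proof.
intro Hx.
apply (is_derive_ext_loc (fun y => Rpower y p)).
- exists (mkposreal x Hx). intros y Hy. symmetry; apply ppow_Rpower.
  unfold ball in Hy; simpl in Hy. unfold AbsRing_ball, abs, minus, plus, opp in Hy; simpl in Hy.
  apply Rabs_def2 in Hy; lra.
- apply is_derive_Reals, derivable_pt_lim_power, Hx.
Qed.

Lemma continuous_ppow p x : 0 < p -> continuous (ppow p) x.
Proof.
intro Hp.
destruct (Rlt_le_dec 0 x) as [Hx|Hx].
- apply @ex_derive_continuous. eexists. now apply is_derive_ppow.
- apply continuity_pt_filterlim.
  intros eps Heps.
  (* With delta = eps^(1/p) and x <= 0, any y closer than delta to x satisfies y < delta, hence y^p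
     < eps; this treats x = 0 and x < 0 together. *)
  exists (ppow (/ p) eps). split; [now apply ppow_gt0|].
  intros y [_ Hy]. unfold dist in *; simpl in *; unfold R_dist in *.
  rewrite (ppow_nonpos p x) by lra. rewrite Rminus_0_r, Rabs_pos_eq by apply ppow_ge0.
  destruct (Rle_lt_dec y 0) as [H|H]; [now rewrite ppow_nonpos|].
  rewrite <- (ppow_ppow_inv p (/ p) eps) by (try field; lra).
  assert (y < ppow (/ p) eps) by (apply Rabs_def2 in Hy; lra).
  rewrite !(ppow_Rpower p) by lra. apply Rlt_Rpower_l; lra.
Qed.

Lemma continuous_Rpower p x : 0 < x -> continuous (fun y => Rpower y p) x.
Proof.
intro Hx. apply @ex_derive_continuous. eexists.
apply is_derive_Reals. now apply derivable_pt_lim_power.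
Qed.

Lemma continuous_Rmax a x : continuous (Rmax a) x.
Proof.
apply (continuous_ext (fun y => (a + y + Rabs (y - a)) / 2)).
{ intro y. unfold Rmax, Rabs. destruct (Rle_dec a y), (Rcase_abs (y - a)); lra. }
apply (continuous_mult (fun y => a + y + Rabs (y - a)) (fun _ => / 2)); [|apply continuous_const].
apply (continuous_plus (fun y => a + y)).
- apply (continuous_plus (fun _ => a)). apply continuous_const. apply continuous_id.
- apply (continuous_comp (fun y => y - a)).
  apply (continuous_minus (fun y : R => y)). apply continuous_id. apply continuous_const.
  apply continuous_Rabs.
Qed.

Lemma continuous_const_sub (r : R) (f : R -> R) (x : R) :
  continuous f x -> continuous (fun y => r - f y) x.
Proof. intro Hf. apply (continuous_minus (fun _ => r)); [apply continuous_const|easy]. Qed.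

Lemma continuous_RInt_param (F : R -> R -> R) (a b x : R) :
  a <= b -> (forall p : R * R, continuous (fun q : R * R => F (fst q) (snd q)) p) ->
  continuous (fun y => RInt (F y) a b) x.
Proof.
intros Hab HF.
assert (HI : forall y, ex_RInt (F y) a b).
{ intro y. apply @ex_RInt_continuous. intros z _.
  apply (continuous_comp_2 (fun _ : R => y) (fun z : R => z) F z).
  apply continuous_const. apply continuous_id. apply HF. }
apply continuity_pt_filterlim. intros eps Heps.
(* The summand 1 keeps the denominator positive when a = b and makes the final inequality strict. *)
assert (He : 0 < eps / (b - a + 1)) by (apply Rdiv_lt_0_compat; lra).
destruct (uniform_continuity_2d_1d' F a b x) with (eps := mkposreal _ He) as [d Hd].
{ intros z _. apply continuity_2d_pt_filterlim. apply (HF (x, z)). }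
exists d. split; [apply cond_pos|].
intros y [_ Hy]. unfold dist in *; simpl in *; unfold R_dist in *.
change (Rabs (minus (RInt (F y) a b) (RInt (F x) a b)) < eps).
rewrite <- RInt_minus by apply HI.
apply Rle_lt_trans with ((b - a) * (eps / (b - a + 1))).
- apply abs_RInt_le_const; [easy| |].
  + apply @ex_RInt_minus; apply HI.
  + intros z Hz. apply Rlt_le. apply Rabs_def2 in Hy.
    apply (Hd z x z y); try lra.
    rewrite Rminus_diag, Rabs_R0. apply cond_pos.
- apply Rmult_lt_reg_r with (b - a + 1); [lra|].
  replace ((b - a) * (eps / (b - a + 1)) * (b - a + 1)) with ((b - a) * eps) by (field; lra). nra.
Qed.

(** Substitution z = r^b x, which trades the moving upper limit for the fixed interval [0, 1].
    [Rmax 0 r] is the value of [ppow (/ b) (ppow b r)] for every real r, negative ones included. *)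
Lemma RInt_ppow_scaled (G : R -> R) (b r : R) :
  0 < b -> (forall x, continuous G x) ->
  RInt (fun z => G (ppow (/ b) z)) 0 (ppow b r)
  = ppow b r * RInt (fun x => G (Rmax 0 r * ppow (/ b) x)) 0 1.
Proof.
intros Hb HG.
assert (HN : forall z, continuous (ppow (/ b)) z)
  by (intro; apply continuous_ppow, Rinv_0_lt_compat; lra).
assert (HGN : forall z, continuous (fun z => G (ppow (/ b) z)) z)
  by (intro z; apply continuous_comp; auto).
change Rmult with (@scal R_Ring R_ModuleSpace) at 1.
rewrite <- (RInt_scal (V := R_CompleteNormedModule)).
2:{ apply @ex_RInt_continuous. intros z _.
    apply (continuous_comp (fun x => Rmax 0 r * ppow (/ b) x) G); auto.
    apply (continuous_mult (fun _ => Rmax 0 r)); auto. apply continuous_const. }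
replace (ppow b r) with (ppow b r * 1 + 0) at 1 by ring.
replace 0 with (ppow b r * 0 + 0) at 1 by ring.
rewrite <- RInt_comp_lin.
2: apply @ex_RInt_continuous; auto.
apply RInt_ext. intros x _. unfold scal; simpl; unfold mult; simpl.
f_equal. f_equal. rewrite Rplus_0_r, ppow_mult by apply ppow_ge0. f_equal.
destruct (Rle_lt_dec r 0).
- rewrite (ppow_nonpos b r) by easy. rewrite Rmax_left by easy. apply ppow_nonpos; lra.
- rewrite Rmax_right by lra. apply ppow_ppow_inv; [field|]; lra.
Qed.

(** After rescaling to [0, 1] the integrand is jointly continuous. The free shift c serves both the
    slices of [shell] and the truncated fractional integrals, where c y = -y. *)
Lemma continuous_RInt_ppow (G : R -> R) (b : R) (r c : R -> R) (x : R) :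
  0 < b -> (forall x, continuous G x) ->
  (forall x, continuous r x) -> (forall x, continuous c x) ->
  continuous (fun y => RInt (fun z => G (c y + ppow (/ b) z)) 0 (ppow b (r y))) x.
Proof.
intros Hb HG Hr Hc.
apply (continuous_ext (fun y => ppow b (r y) * RInt (fun x => G (c y + Rmax 0 (r y) * ppow (/ b) x)) 0 1)).
{ intro y. symmetry. apply (RInt_ppow_scaled (fun s => G (c y + s))); [easy|].
  intro z. apply (continuous_comp (fun s => c y + s)); auto.
  apply (continuous_plus (fun _ => c y)). apply continuous_const. apply continuous_id. }
apply (continuous_mult (fun y => ppow b (r y))).
{ apply continuous_comp; auto. now apply continuous_ppow. }
apply (continuous_RInt_param (fun y x => G (c y + Rmax 0 (r y) * ppow (/ b) x))); [lra|].
intros p. apply continuous_comp; auto.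
apply (continuous_plus (fun q : R * R => c (fst q))).
{ apply continuous_comp; auto. apply continuous_fst. }
apply (continuous_mult (fun q : R * R => Rmax 0 (r (fst q)))).
2:{ apply continuous_comp. apply continuous_snd. apply continuous_ppow, Rinv_0_lt_compat; lra. }
apply (continuous_comp (fun q : R * R => r (fst q)) (Rmax 0)); [|apply continuous_Rmax].
apply continuous_comp; auto. apply continuous_fst.
Qed.

(** * Shell integrals and the Gamma function *)

(** This is M_G(r) as an iterated integral. The slice over y closes up exactly at y = r^b, and
    [ppow] makes it empty beyond. *)
Definition shell (b : R) (G : R -> R) (r : R) : R :=
  RInt (fun y => RInt (fun z => G (ppow (/ b) y + ppow (/ b) z)) 0
                   (ppow b (r - ppow (/ b) y))) 0 (ppow b r).

(** The constant V1: the value of [shell b G 1] for G = 1, with the inner integral already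
    evaluated. *)
Definition vol (b : R) : R := RInt (fun y => ppow b (1 - ppow (/ b) y)) 0 1.

Lemma continuous_ppow_sub b r x : 0 < b -> continuous (fun y => ppow b (r - ppow (/ b) y)) x.
Proof.
intro Hb.
apply (continuous_comp (fun y => r - ppow (/ b) y) (ppow b)); [|now apply continuous_ppow].
now apply continuous_const_sub, continuous_ppow, Rinv_0_lt_compat.
Qed.

(** Scaling y = r^b x: the length of the outer interval and the height of each slice both contribute
    a factor r^b. *)
Lemma shell_vol b r : 0 < b -> 0 <= r ->
  RInt (fun y => ppow b (r - ppow (/ b) y)) 0 (ppow b r) = vol b * ppow (2 * b) r.
Proof.
intros Hb Hr.
replace (ppow b r) with (ppow b r * 1 + 0) by ring.
replace 0 with (ppow b r * 0 + 0) at 1 by ring.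
rewrite <- (RInt_comp_lin (V := R_CompleteNormedModule)).
2: apply @ex_RInt_continuous; intros; now apply continuous_ppow_sub.
rewrite (RInt_ext _ (fun y => scal (ppow (2 * b) r) (ppow b (1 - ppow (/ b) y)))).
- rewrite (RInt_scal (V := R_CompleteNormedModule)).
  + unfold vol. apply Rmult_comm.
  + apply @ex_RInt_continuous; intros; now apply continuous_ppow_sub.
- intros x _. unfold scal; simpl; unfold mult; simpl.
  replace (2 * b) with (b + b) by ring. rewrite ppow_plus.
  rewrite Rplus_0_r, ppow_mult by apply ppow_ge0.
  replace (ppow (/ b) (ppow b r)) with r by (symmetry; now apply ppow_inv_l).
  replace (r - r * ppow (/ b) x) with (r * (1 - ppow (/ b) x)) by ring.
  rewrite ppow_mult by easy. ring.
Qed.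

Lemma RInt_near_const (f : R -> R) x y g e : x <= y -> (forall z, continuous f z) ->
  (forall z, x < z < y -> Rabs (f z - g) <= e) ->
  Rabs (RInt f x y - g * (y - x)) <= e * (y - x).
Proof.
intros Hxy Hf H.
assert (Hc : forall c : R, RInt (fun _ => c) x y = c * (y - x)).
{ intro c. rewrite RInt_const. apply Rmult_comm. }
apply Rabs_le.
assert (RInt (fun _ => g - e) x y <= RInt f x y <= RInt (fun _ => g + e) x y); [split|].
1,2 : apply RInt_le; auto.
1,5 : apply ex_RInt_const.
1,3 : now apply @ex_RInt_continuous.
1,2 : intros z Hz; specialize (H z Hz); apply Rabs_le_between in H; lra.
rewrite !Hc in H0. lra.
Qed.

Lemma RInt_Chasles_minus (f : R -> R) x y : (forall z, continuous f z) ->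
  RInt f 0 y - RInt f 0 x = RInt f x y.
Proof.
intro Hf.
rewrite <- (RInt_Chasles (V := R_CompleteNormedModule) f 0 x y).
2,3 : now apply @ex_RInt_continuous.
unfold plus; simpl. ring.
Qed.

Lemma continuous_add_ppow b (G : R -> R) c x : 0 < b -> (forall x, continuous G x) ->
  continuous (fun z => G (c + ppow (/ b) z)) x.
Proof.
intros Hb HG.
apply (continuous_comp (fun z => c + ppow (/ b) z) G); auto.
apply (continuous_plus (fun _ => c)). apply continuous_const.
now apply continuous_ppow, Rinv_0_lt_compat.
Qed.

Lemma continuous_shell_slice b (G : R -> R) r x : 0 < b -> (forall x, continuous G x) ->
  continuous (fun y => RInt (fun z => G (ppow (/ b) y + ppow (/ b) z)) 0 (ppow b (r - ppow (/ b) y))) x.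
Proof.
intros Hb HG.
apply (continuous_RInt_ppow G b (fun y => r - ppow (/ b) y) (ppow (/ b))); auto; intro;
  [apply continuous_const_sub|]; now apply continuous_ppow, Rinv_0_lt_compat.
Qed.

(** Slices beyond r^b are empty, so the outer range may be enlarged. Quantities at r and r' then
    share one range and can be subtracted under the integral. *)
Lemma RInt_shell_ext b (f : R -> R -> R) r r' : 0 < b -> 0 <= r <= r' -> (forall r x, continuous (f r) x) ->
  (forall r y, r <= ppow (/ b) y -> f r y = 0) ->
  RInt (f r) 0 (ppow b r) = RInt (f r) 0 (ppow b r').
Proof.
intros Hb Hr Hf H0.
assert (Hib : 0 < / b) by now apply Rinv_0_lt_compat.
assert (ppow b r <= ppow b r') by (apply ppow_le; lra).
apply Rminus_diag_uniq_sym. rewrite RInt_Chasles_minus by auto.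
rewrite (RInt_ext _ (fun _ => 0)).
- rewrite RInt_const. apply Rmult_0_r.
- intros x Hx. rewrite Rmin_left, Rmax_right in Hx by easy. apply H0.
  rewrite <- (ppow_inv_l b r) by easy. apply ppow_le; lra.
Qed.

(** Over a common outer range, the difference of two slices is an integral over those z for which
    y^(1/b) + z^(1/b) lies between r and r', where G is within e of g. The factor of g is the volume
    of this thin shell. *)
Lemma shell_incr b (G : R -> R) r r' g e : 0 < b -> (forall x, continuous G x) -> 0 <= r <= r' ->
  (forall s, r <= s <= r' -> Rabs (G s - g) <= e) ->
  Rabs (shell b G r' - shell b G r - g * (vol b * ppow (2 * b) r' - vol b * ppow (2 * b) r))
  <= e * (vol b * ppow (2 * b) r' - vol b * ppow (2 * b) r).
Proof.
intros Hb HG Hr H.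
assert (Hib : 0 < / b) by now apply Rinv_0_lt_compat.
rewrite <- !shell_vol by lra. unfold shell.
rewrite (RInt_shell_ext b (fun r y => RInt (fun z => G (ppow (/ b) y + ppow (/ b) z)) 0 (ppow b (r - ppow (/ b) y))) r r'); [|easy|easy|intros; now apply continuous_shell_slice|].
2:{ intros s y Hs. rewrite (ppow_nonpos _ (s - ppow (/ b) y)) by lra. apply (RInt_point (V := R_CompleteNormedModule)). }
rewrite (RInt_shell_ext b (fun r y => ppow b (r - ppow (/ b) y)) r r'); [|easy|easy|intros; now apply continuous_ppow_sub|].
2:{ intros s y Hs. apply ppow_nonpos; lra. }
set (F s y := RInt (fun z => G (ppow (/ b) y + ppow (/ b) z)) 0 (ppow b (s - ppow (/ b) y))).
assert (HF : forall s, ex_RInt (F s) 0 (ppow b r')) by (intro; apply @ex_RInt_continuous; intros; now apply continuous_shell_slice).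
assert (HP : forall s, ex_RInt (fun y => ppow b (s - ppow (/ b) y)) 0 (ppow b r')) by (intro; apply @ex_RInt_continuous; intros; now apply continuous_ppow_sub).
change (Rabs (minus (minus (RInt (F r') 0 (ppow b r')) (RInt (F r) 0 (ppow b r')))
   (scal g (minus (RInt (fun y => ppow b (r' - ppow (/ b) y)) 0 (ppow b r')) (RInt (fun y => ppow b (r - ppow (/ b) y)) 0 (ppow b r')))))
  <= scal e (minus (RInt (fun y => ppow b (r' - ppow (/ b) y)) 0 (ppow b r')) (RInt (fun y => ppow b (r - ppow (/ b) y)) 0 (ppow b r')))).
rewrite <- !(RInt_minus (V := R_CompleteNormedModule)) by auto.
rewrite <- !(RInt_scal (V := R_CompleteNormedModule)) by now apply @ex_RInt_minus.
rewrite <- (RInt_minus (V := R_CompleteNormedModule)).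
2: now apply @ex_RInt_minus.
2: now apply @ex_RInt_scal, @ex_RInt_minus.
eapply Rle_trans; [apply abs_RInt_le|apply RInt_le].
1, 3: apply ppow_ge0.
- apply @ex_RInt_minus. now apply @ex_RInt_minus.
  now apply @ex_RInt_scal, @ex_RInt_minus.
- apply (ex_RInt_norm (fun x => minus (minus (F r' x) (F r x)) (scal g (minus (ppow b (r' - ppow (/ b) x)) (ppow b (r - ppow (/ b) x)))))).
  apply @ex_RInt_minus. now apply @ex_RInt_minus.
  now apply @ex_RInt_scal, @ex_RInt_minus.
- now apply @ex_RInt_scal, @ex_RInt_minus.
- intros y Hy.
  change (Rabs (F r' y - F r y - g * (ppow b (r' - ppow (/ b) y) - ppow b (r - ppow (/ b) y))) <= e * (ppow b (r' - ppow (/ b) y) - ppow b (r - ppow (/ b) y))).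
  unfold F. rewrite RInt_Chasles_minus by (intro; now apply continuous_add_ppow).
  assert (ppow b (r - ppow (/ b) y) <= ppow b (r' - ppow (/ b) y)) by (apply ppow_le; lra).
  apply RInt_near_const; [easy|intro; now apply continuous_add_ppow|].
  intros z Hz. apply H.
  assert (0 <= z). { assert (0 <= ppow b (r - ppow (/ b) y)) by apply ppow_ge0. lra. }
  assert (Ny : ppow (/ b) y <= r'). { rewrite <- (ppow_inv_l b r') by lra. apply ppow_le; lra. }
  split.
  (* If y^(1/b) >= r the lower bound is immediate; otherwise it comes from z > (r - y^(1/b))^b. *)
  + destruct (Rle_lt_dec r (ppow (/ b) y)). { assert (0 <= ppow (/ b) z) by apply ppow_ge0; lra. }
    assert (ppow (/ b) (ppow b (r - ppow (/ b) y)) <= ppow (/ b) z) by (apply ppow_le; lra).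
    rewrite ppow_inv_l in H2 by lra. lra.
  + assert (ppow (/ b) z <= ppow (/ b) (ppow b (r' - ppow (/ b) y))) by (apply ppow_le; lra).
    rewrite ppow_inv_l in H2 by lra. lra.
Qed.

Lemma shell_0 b G : shell b G 0 = 0.
Proof. unfold shell. rewrite (ppow_nonpos b 0) by lra. apply (RInt_point (V := R_CompleteNormedModule)). Qed.

(** A version of zero derivative implies constant, with V as the measure of length: over a fine
    subdivision of [0, r] the bounds telescope to |D r - D 0| <= eps (V r - V 0) for every eps. *)
Lemma increments_dominated_eq (D V : R -> R) (r : R) : 0 <= r ->
  (forall eps, 0 < eps -> exists delta, 0 < delta /\ forall x y, 0 <= x <= y -> y <= r ->
     y - x < delta -> Rabs (D y - D x) <= eps * (V y - V x)) ->
  D r = D 0.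
Proof.
intros Hr H.
assert (K : forall eps, 0 < eps -> Rabs (D r - D 0) <= eps * (V r - V 0)).
{ intros eps He. destruct (H eps He) as [d [Hd Hx]].
  (* With n the floor of r / d, cutting [0, r] into n + 1 equal pieces makes each shorter than d. *)
  destruct (nfloor_ex (r / d)) as [n Hn].
  { apply Rdiv_le_0_compat; lra. }
  set (m := INR (S n)).
  assert (Hm : 0 < m) by (apply lt_0_INR; lia).
  assert (Hrm : r / m < d).
  { apply Rmult_lt_reg_r with (m / d). now apply Rdiv_lt_0_compat.
    replace (r / m * (m / d)) with (r / d) by (field; lra).
    replace (d * (m / d)) with m by (field; lra). unfold m. rewrite S_INR. lra. }
  assert (Hrm0 : 0 <= r / m) by (apply Rdiv_le_0_compat; lra).
  assert (I : forall k, (k <= S n)%nat ->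
     Rabs (D (r / m * INR k) - D 0) <= eps * (V (r / m * INR k) - V 0)).
  { induction k; intro Hk.
    - simpl. rewrite Rmult_0_r, !Rminus_diag, Rabs_R0. lra.
    - assert (J := Hx (r / m * INR k) (r / m * INR (S k))).
      assert (INR (S k) <= m) by (apply le_INR; lia).
      assert (r / m * INR (S k) <= r).
      { replace r with (r / m * m) at 2 by (field; lra). apply Rmult_le_compat_l; easy. }
      specialize (IHk ltac:(lia)). rewrite S_INR in *.
      assert (0 <= INR k) by apply pos_INR.
      specialize (J ltac:(nra) ltac:(nra) ltac:(nra)).
      replace (D (r / m * (INR k + 1)) - D 0) with
       ((D (r / m * (INR k + 1)) - D (r / m * INR k)) + (D (r / m * INR k) - D 0)) by ring.
      eapply Rle_trans; [apply Rabs_triang|]. lra. }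
  specialize (I (S n) (le_n _)). fold m in I.
  replace (r / m * m) with r in I by (field; lra). exact I. }
destruct (Req_dec (D r) (D 0)) as [|Hne]; [easy|exfalso].
assert (Hp : 0 < Rabs (D r - D 0)) by (apply Rabs_pos_lt; lra).
set (w := V r - V 0) in *.
(* eps = 1 forces w > 0, so that eps = |D r - D 0| / (2 w) is admissible and halves a positive
   number. *)
assert (K1 := K 1 Rlt_0_1).
assert (K2 := K (Rabs (D r - D 0) / (2 * w)) ltac:(apply Rdiv_lt_0_compat; lra)).
replace (Rabs (D r - D 0) / (2 * w) * w) with (Rabs (D r - D 0) / 2) in K2 by (field; lra).
lra.
Qed.

(** On a short interval [x, y] both sides grow by nearly G(x) V1 (y^(2b) - x^(2b)), with an error
    that is a small multiple of V1 (y^(2b) - x^(2b)). Their difference therefore has dominated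
    increments, and it vanishes at 0. *)
Lemma shell_eq (b : R) (G : R -> R) (r : R) :
  0 < b -> 0 <= r -> (forall x, continuous G x) ->
  shell b G r = vol b * RInt (fun z => G (ppow (/ (2 * b)) z)) 0 (ppow (2 * b) r).
Proof.
intros Hb Hr HG.
set (Q r := RInt (fun z => G (ppow (/ (2 * b)) z)) 0 (ppow (2 * b) r)).
assert (Hv : 0 <= vol b).
{ apply RInt_ge_0; [lra| |intros; apply ppow_ge0].
  apply @ex_RInt_continuous; intros; now apply continuous_ppow_sub. }
assert (Hc : forall z, continuous (fun z => G (ppow (/ (2 * b)) z)) z).
{ intro z. apply continuous_comp; auto. apply continuous_ppow, Rinv_0_lt_compat. lra. }
assert (HQ : forall x y g e, 0 <= x <= y -> (forall s, x <= s <= y -> Rabs (G s - g) <= e) ->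
  Rabs (Q y - Q x - g * (ppow (2 * b) y - ppow (2 * b) x)) <= e * (ppow (2 * b) y - ppow (2 * b) x)).
{ intros x y g e Hxy H. unfold Q. rewrite RInt_Chasles_minus by auto.
  assert (ppow (2 * b) x <= ppow (2 * b) y) by (apply ppow_le; lra).
  apply RInt_near_const; auto.
  intros z Hz. apply H.
  rewrite <- (ppow_inv_l (2 * b) x), <- (ppow_inv_l (2 * b) y) by lra.
  split; apply ppow_le; try lra; apply Rlt_le, Rinv_0_lt_compat; lra. }
apply Rminus_diag_uniq.
etransitivity; [apply (increments_dominated_eq (fun r => shell b G r - vol b * Q r) (fun r => vol b * ppow (2 * b) r) r Hr)|].
2:{ rewrite shell_0. unfold Q. rewrite (ppow_nonpos _ 0) by lra.
  rewrite (RInt_point (V := R_CompleteNormedModule)). unfold zero; simpl. ring. }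
  intros eps He.
  (* Half of eps for each of the two increments compared. *)
  destruct (unifcont_1d G 0 r) with (eps := mkposreal (eps / 2) ltac:(lra)) as [d Hd].
  { intros; apply HG. }
  exists d. split; [apply cond_pos|]. intros x y Hxy Hyr Hyx.
  assert (K : forall s, x <= s <= y -> Rabs (G s - G x) <= eps / 2).
  { intros s Hs. apply Rnot_lt_le. intro Hlt. apply (Hd x s); try lra.
    - change (Rabs (s - x) < d). rewrite Rabs_pos_eq; lra.
    - change (~ Rabs (G s - G x) < eps / 2). lra. }
  assert (K1 := shell_incr b G x y (G x) (eps / 2) Hb HG Hxy K).
  assert (K2 := HQ x y (G x) (eps / 2) Hxy K).
  apply (Rmult_le_compat_l (vol b)) in K2; [|easy].
  rewrite <- (Rabs_pos_eq (vol b)) in K2 at 1 by easy. rewrite <- Rabs_mult in K2.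
  apply Rabs_le_between in K1, K2. apply Rabs_le. lra.
Qed.

(** The double limit of an integral improper at both ends decouples into one limit of a primitive at
    each end. *)
Lemma is_RInt_gen_sub {Fa Fb : (R -> Prop) -> Prop} {FFa : Filter Fa} {FFb : Filter Fb}
  (f U W : R -> R) (lu lw : R) :
  filter_prod Fa Fb (fun ab => is_RInt f (fst ab) (snd ab) (U (snd ab) - W (fst ab))) ->
  filterlim U Fb (locally lu) -> filterlim W Fa (locally lw) ->
  is_RInt_gen f Fa Fb (lu - lw).
Proof.
intros H HU HW.
unfold is_RInt_gen.
apply (filterlimi_lim_ext_loc (fun ab : R * R => U (snd ab) - W (fst ab))); [exact H|].
apply (filterlim_comp_2 (G := locally lu) (H := locally (- lw))
  (fun ab : R * R => U (snd ab)) (fun ab : R * R => - W (fst ab)) Rplus).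
- eapply filterlim_comp; [apply filterlim_snd|exact HU].
- eapply filterlim_comp; [|apply (filterlim_opp (V := R_NormedModule))].
  eapply filterlim_comp; [apply filterlim_fst|exact HW].
- apply (filterlim_plus (V := R_NormedModule)).
Qed.

Lemma continuous_RInt_upper (f : R -> R) (x : R) :
  (forall z, continuous f z) -> continuous (fun y => RInt f 0 y) x.
Proof.
intros Hf. apply @ex_derive_continuous. exists (f x).
apply (is_derive_RInt f (fun y => RInt f 0 y) 0 x); auto.
exists (mkposreal 1 Rlt_0_1). intros y _. apply (RInt_correct (V := R_CompleteNormedModule)).
now apply @ex_RInt_continuous.
Qed.

(** Substitution z = x^b, whose derivative b x^(b-1) absorbs the kernel. Both ends are positive
    here; the passage to 0 is made later on the proper integral. *)
Lemma is_RInt_power_kernel (b : R) (f : R -> R) (a c : R) :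
  0 < b -> 0 < a -> 0 < c -> (forall x, Rmin a c <= x <= Rmax a c -> continuous f x) ->
  is_RInt (fun x => Rpower x (b - 1) * f x) a c
    (/ b * RInt (fun z => f (ppow (/ b) z)) (ppow b a) (ppow b c)).
Proof.
intros Hb Ha Hc Hf.
assert (Hpos : forall x, Rmin a c <= x -> 0 < x).
{ intro x. unfold Rmin. destruct (Rle_dec a c); lra. }
apply (is_RInt_ext (fun x => scal (/ b) (scal (b * Rpower x (b - 1)) (f (ppow (/ b) (ppow b x)))))).
{ intros x Hx. unfold scal; simpl; unfold mult; simpl.
  rewrite ppow_inv_l; [field; lra|easy|]. apply Rlt_le, Hpos; lra. }
apply (is_RInt_scal (V := R_NormedModule)).
apply (is_RInt_comp (V := R_CompleteNormedModule) (fun z => f (ppow (/ b) z))).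
- intros x Hx. apply (continuous_comp (ppow (/ b)) f).
  apply continuous_ppow. now apply Rinv_0_lt_compat.
  rewrite ppow_inv_l; auto. apply Rlt_le, Hpos; lra.
- intros x Hx. assert (0 < x) by (apply Hpos; lra). split.
  + now apply is_derive_ppow.
  + apply (continuous_mult (fun _ => b)). apply continuous_const.
    apply (continuous_ext_loc _ (ppow (b - 1))); [|apply @ex_derive_continuous; eexists; now apply is_derive_ppow].
    exists (mkposreal x H). intros y Hy. apply ppow_Rpower.
    change (Rabs (y - x) < x) in Hy. apply Rabs_def2 in Hy. lra.
Qed.

(** Convergence to the supremum. The bound [E x0 <= l] is what later makes Gamma positive. *)
Lemma is_lim_increasing_bounded (E : R -> R) (x0 B : R) :
  (forall x y, x <= y -> E x <= E y) -> (forall x, E x <= B) ->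
  exists l, E x0 <= l /\ filterlim E (Rbar_locally p_infty) (locally l).
Proof.
intros Hi HB.
destruct (completeness (fun v => exists x, v = E x)) as [l [Hu Hl]].
{ exists B. intros v [x ->]. apply HB. }
{ exists (E x0). now exists x0. }
exists l. split; [apply Hu; now exists x0|].
apply filterlim_locally. intros eps.
assert (exists x, l - eps < E x) as [x Hx].
{ apply Classical_Pred_Type.not_all_not_ex. intro H.
  assert (l <= l - eps); [|destruct eps; simpl in *; lra].
  apply Hl. intros v [x ->]. apply Rnot_lt_le, H. }
exists x. intros y Hy. change (Rabs (E y - l) < eps).
assert (E x <= E y) by (apply Hi; lra).
assert (E y <= l) by (apply Hu; now exists y).
apply Rabs_def1; destruct eps; simpl in *; lra.
Qed.

Lemma continuous_exp_ppow (p x : R) : 0 < p -> continuous (fun z => exp (- ppow p z)) x.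
Proof.
intro Hp. apply (continuous_comp (fun z => - ppow p z) exp).
apply (continuous_opp (V := R_NormedModule)). now apply continuous_ppow.
apply continuous_exp.
Qed.

(** The substitution z = x^b turns b Gamma(b) into the integral of exp(-z^(1/b)) over the half-line.
    It increases with its upper limit, and 1/b >= 1 allows comparison with exp(-z) beyond z = 1. *)
Lemma Gamma_lim (b : R) : 0 < b <= 1 ->
  is_lim (fun r => RInt (fun z => exp (- ppow (/ b) z)) 0 (ppow b r)) p_infty (b * Gamma b)
  /\ 0 < Gamma b.
Proof.
intros Hb.
assert (Hib : 0 < / b) by (apply Rinv_0_lt_compat; lra).
assert (Hib1 : 1 <= / b) by (rewrite <- Rinv_1 at 1; apply Rinv_le_contravar; lra).
set (e z := exp (- ppow (/ b) z)).
assert (Hc : forall z, continuous e z) by (intro; now apply continuous_exp_ppow).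
assert (Hp : forall z, 0 < e z) by (intro; apply exp_pos).
set (E r := RInt e 0 (ppow b r)).
assert (Hx : forall x y, ex_RInt e x y) by (intros; now apply @ex_RInt_continuous).
(* The bound 2 is 1 from [0, 1], where the integrand is at most 1, plus exp(-1) <= 1 from the
   tail. *)
destruct (is_lim_increasing_bounded E 1 2) as [l [Hl1 Hl]].
{ intros x y Hxy. unfold E. apply Rminus_le_0. rewrite RInt_Chasles_minus by auto.
  apply RInt_ge_0; auto. apply ppow_le; lra. intros; now apply Rlt_le. }
{ intros x. unfold E.
  assert (HM : ppow b x <= Rmax 1 (ppow b x)) by apply Rmax_r.
  assert (HM1 : 1 <= Rmax 1 (ppow b x)) by apply Rmax_l.
  set (M := Rmax 1 (ppow b x)) in *.
  apply Rle_trans with (RInt e 0 M).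
  { apply Rminus_le_0. rewrite RInt_Chasles_minus by auto.
    apply RInt_ge_0; auto. intros; now apply Rlt_le. }
  assert (H1 : RInt e 0 1 <= 1).
  { replace 1 with (RInt (fun _ => 1) 0 1) at 2.
    2:{ rewrite RInt_const. unfold scal; simpl; unfold mult; simpl. ring. }
    apply RInt_le; auto. lra. apply ex_RInt_const.
    intros z Hz. unfold e. rewrite <- exp_0.
    assert (0 <= ppow (/ b) z) by apply ppow_ge0.
    destruct H as [H|H]. left; apply exp_increasing; lra. right; f_equal; lra. }
  assert (HI : is_RInt (fun z => exp (- z)) 1 M (minus (- exp (- M)) (- exp (- 1)))).
  { apply (is_RInt_derive (fun z => - exp (- z))).
    - intros z _. auto_derive; [easy|]. ring.
    - intros z _. apply (continuous_comp Ropp exp). apply (continuous_opp (V := R_NormedModule)), continuous_id. apply continuous_exp. }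
  assert (H2 : RInt e 1 M <= exp (- 1)).
  { apply Rle_trans with (RInt (fun z => exp (- z)) 1 M).
    - apply RInt_le; auto. eexists; exact HI.
      intros z Hz. unfold e.
      assert (z <= ppow (/ b) z).
      { rewrite ppow_Rpower by lra. rewrite <- (Rpower_1 z) at 1 by lra. apply Rle_Rpower; lra. }
      destruct H as [H|H]. left; apply exp_increasing; lra. right; f_equal; lra.
    - rewrite (is_RInt_unique _ _ _ _ HI). unfold minus, plus, opp; simpl.
      assert (0 < exp (- M)) by apply exp_pos. lra. }
  assert (exp (- 1) <= 1). { rewrite <- exp_0. left; apply exp_increasing; lra. }
  assert (HC := RInt_Chasles (V := R_CompleteNormedModule) e 0 1 M (Hx _ _) (Hx _ _)).
  change plus with Rplus in HC. lra. }
assert (HE1 : 0 < E 1). { unfold E. rewrite ppow_1. apply RInt_gt_0; auto; lra. }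
assert (HG : Gamma b = / b * l).
{ unfold Gamma. apply is_RInt_gen_unique.
  replace (/ b * l) with (/ b * l - / b * E 0).
  2:{ unfold E. rewrite ppow_nonpos by lra. rewrite (RInt_point (V := R_CompleteNormedModule)). unfold zero; simpl; ring. }
  apply (is_RInt_gen_sub _ (fun r => / b * E r) (fun r => / b * E r)).
  - apply Filter_prod with (Q := fun x => 0 < x) (R := fun x => 0 < x).
    + exists (mkposreal 1 Rlt_0_1). easy.
    + now exists 0.
    + intros x y Hx0 Hy0. unfold fst, snd.
      replace (/ b * E y - / b * E x) with (/ b * RInt e (ppow b x) (ppow b y)).
      2:{ rewrite <- RInt_Chasles_minus by auto. unfold E. ring. }
      apply (is_RInt_power_kernel b (fun z => exp (- z))); auto; try lra.
      intros z _. apply (continuous_comp Ropp exp). apply (continuous_opp (V := R_NormedModule)), continuous_id. apply continuous_exp.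
  - eapply filterlim_comp; [exact Hl|]. apply (filterlim_scal_r (V := R_NormedModule)).
  - eapply filterlim_comp; [|apply (filterlim_scal_r (V := R_NormedModule))].
    apply (filterlim_filter_le_1 (F := locally 0)); [apply filter_le_within|].
    apply (continuous_comp (ppow b) (fun y => RInt e 0 y)). apply continuous_ppow; lra.
    now apply continuous_RInt_upper. }
split.
- rewrite HG. replace (b * (/ b * l)) with l by (field; lra). exact Hl.
- rewrite HG. apply Rmult_lt_0_compat; lra.
Qed.

(** For G(s) = exp(-s) the integrand is a product of a function of y and one of z, and the region
    y^(1/b) + z^(1/b) <= r lies between the squares of sides (r/2)^b and r^b. The integrals over
    both squares tend to (b Gamma(b))^2, while [shell_eq] gives the limit V1 2b Gamma(2b). *)
Lemma vol_Gamma (b : R) : 0 < b -> 2 * b <= 1 ->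
  vol b * (2 * b * Gamma (2 * b)) = (b * Gamma b) ^ 2.
Proof.
intros Hb Hb2.
assert (Hib : 0 < / b) by now apply Rinv_0_lt_compat.
destruct (Gamma_lim b ltac:(lra)) as [L1 _].
destruct (Gamma_lim (2 * b) ltac:(lra)) as [L2 _].
set (e z := exp (- ppow (/ b) z)) in *.
assert (Hc : forall z, continuous e z) by (intro; now apply continuous_exp_ppow).
assert (Hx : forall x y, ex_RInt e x y) by (intros; now apply @ex_RInt_continuous).
assert (Hp : forall z, 0 < e z) by (intro; apply exp_pos).
set (E r := RInt e 0 (ppow b r)) in *.
set (G s := exp (- s)).
assert (HG : forall s, continuous G s).
{ intro s. apply (continuous_comp Ropp exp). apply (continuous_opp (V := R_NormedModule)), continuous_id. apply continuous_exp. }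
assert (L3 : is_lim (shell b G) p_infty (vol b * (2 * b * Gamma (2 * b)))).
{ apply (is_lim_scal_l _ (vol b)) in L2.
  eapply is_lim_ext_loc; [|exact L2]. exists 0. intros r Hr. symmetry; apply shell_eq; auto; lra. }
assert (Hincr : forall x y, 0 <= x -> x <= y -> RInt e 0 x <= RInt e 0 y).
{ intros x y Hx0 Hxy. apply Rminus_le_0. rewrite RInt_Chasles_minus by auto.
    apply RInt_ge_0; auto. intros; now apply Rlt_le. }
assert (He0 : forall x, 0 <= x -> 0 <= RInt e 0 x).
{ intros. apply RInt_ge_0; auto. intros; now apply Rlt_le. }
set (F r y := RInt (fun z => G (ppow (/ b) y + ppow (/ b) z)) 0 (ppow b (r - ppow (/ b) y))).
assert (HF : forall r x y, ex_RInt (F r) x y) by (intros; apply @ex_RInt_continuous; intros; now apply continuous_shell_slice).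
assert (HFe : forall r y, F r y = e y * RInt e 0 (ppow b (r - ppow (/ b) y))).
{ intros r y. rewrite <- (RInt_scal (V := R_CompleteNormedModule) e _ _ (e y)) by auto.
  apply RInt_ext. intros x _. unfold scal; simpl; unfold mult; simpl. unfold G, e.
  rewrite <- exp_plus. f_equal. ring. }
assert (Hsc : forall x k, RInt (fun y => e y * k) 0 x = RInt e 0 x * k).
{ intros x k. rewrite Rmult_comm. rewrite <- (RInt_scal (V := R_CompleteNormedModule) e _ _ k) by auto.
  apply RInt_ext. intros. apply Rmult_comm. }
assert (Hsx : forall x y k, ex_RInt (fun y => e y * k) x y).
{ intros. apply @ex_RInt_continuous. intros. apply (continuous_mult e (fun _ => k)); auto. apply continuous_const. }
assert (Hup : forall r, 0 < r -> shell b G r <= E r * E r).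
{ intros r Hr. unfold E at 1. rewrite <- Hsc.
  change (RInt (F r) 0 (ppow b r) <= RInt (fun y => e y * E r) 0 (ppow b r)).
  apply RInt_le; auto. apply ppow_ge0.
  intros y Hy. rewrite HFe. apply Rmult_le_compat_l; [now apply Rlt_le|].
  apply Hincr. apply ppow_ge0. apply ppow_le; try lra.
  assert (0 <= ppow (/ b) y) by apply ppow_ge0; lra. }
(* Inner square: y^(1/b) <= r/2 leaves r - y^(1/b) >= r/2 for z^(1/b). *)
assert (Hlo : forall r, 0 < r -> E (/ 2 * r) * E (/ 2 * r) <= shell b G r).
{ intros r Hr.
  assert (ppow b (/ 2 * r) <= ppow b r) by (apply ppow_le; lra).
  apply Rle_trans with (RInt (F r) 0 (ppow b (/ 2 * r))).
  - unfold E at 1. rewrite <- Hsc.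
    apply RInt_le; auto. apply ppow_ge0.
    intros y Hy. rewrite HFe. apply Rmult_le_compat_l; [now apply Rlt_le|].
    apply Hincr. apply ppow_ge0. apply ppow_le; try lra.
    assert (ppow (/ b) y <= / 2 * r); [|lra].
    rewrite <- (ppow_inv_l b (/ 2 * r)) by lra. apply ppow_le; lra.
  - change (RInt (F r) 0 (ppow b (/ 2 * r)) <= RInt (F r) 0 (ppow b r)).
    apply Rminus_le_0. rewrite RInt_Chasles_minus by (intro; now apply continuous_shell_slice).
    apply RInt_ge_0; auto. intros y _. rewrite HFe.
    apply Rmult_le_pos; [now apply Rlt_le|]. apply He0, ppow_ge0. }
assert (L4 : is_lim (fun r => E r * E r) p_infty ((b * Gamma b) ^ 2)).
{ replace ((b * Gamma b) ^ 2) with ((b * Gamma b) * (b * Gamma b)) by ring.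
  now apply (is_lim_mult E E p_infty (b * Gamma b) (b * Gamma b)). }
assert (L5 : is_lim (fun r => E (/ 2 * r) * E (/ 2 * r)) p_infty ((b * Gamma b) ^ 2)).
{ apply (is_lim_comp (fun r => E r * E r) (fun r => / 2 * r) p_infty _ p_infty); [exact L4| |].
  - intros Q [M HM]. exists (2 * M). intros x Hxm. apply HM. lra.
  - now exists 0. }
apply Rle_antisym.
- apply (is_lim_le_loc _ _ p_infty (Finite _) (Finite _)) with (2 := L3) (3 := L4). now exists 0.
- apply (is_lim_le_loc _ _ p_infty (Finite _) (Finite _)) with (2 := L5) (3 := L3). now exists 0.
Qed.

(** * Differentiation of fractional integrals *)

Lemma is_RInt_RL_kernel (b : R) (f : R -> R) (t a c : R) :
  0 < b -> a < t -> c < t -> (forall x, Rmin a c <= x <= Rmax a c -> continuous f x) ->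
  is_RInt (fun s => Rpower (t - s) (b - 1) * f s) a c
    (/ b * RInt (fun z => f (t - ppow (/ b) z)) (ppow b (t - c)) (ppow b (t - a))).
Proof.
intros Hb Ha Hc Hf.
assert (H := is_RInt_power_kernel b (fun x => f (t - x)) (t - c) (t - a) Hb ltac:(lra) ltac:(lra)).
(* Reflection s = t - x reverses the orientation; the outer [opp] pairs with the swap of the ends
   below. *)
apply (is_RInt_ext (fun y => opp (scal (-1) (Rpower (-1 * y + t) (b - 1) * f (t - (-1 * y + t)))))).
{ intros x _. unfold opp, scal; simpl; unfold mult; simpl.
  replace (-1 * x + t) with (t - x) by ring. replace (t - (t - x)) with x by ring. ring. }
set (v := / b * _).
rewrite <- (Ropp_involutive v).
apply (is_RInt_opp (V := R_NormedModule)).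
apply (is_RInt_comp_lin (V := R_NormedModule) (fun x => Rpower x (b - 1) * f (t - x))).
replace (-1 * a + t) with (t - a) by ring.
replace (-1 * c + t) with (t - c) by ring.
apply (is_RInt_swap (V := R_NormedModule)).
apply H. intros x Hx. apply (continuous_comp (fun x => t - x) f).
apply continuous_const_sub. apply continuous_id.
apply Hf. revert Hx. unfold Rmin, Rmax.
destruct (Rle_dec (t - c) (t - a)), (Rle_dec a c); lra.
Qed.

(** After z = (t - s)^b the end s = t becomes the regular point z = 0. Only the end s = 0, that is z
    = t^b, remains improper, and the assumed limit settles it, even for conditional convergence. *)
Lemma is_RL_integral_of_lim (b : R) (f : R -> R) (t l : R) :
  0 < b -> 0 < Gamma b -> 0 < t -> (forall s, 0 < s -> continuous f s) ->
  filterlim (fun e => RInt (fun z => f (t - ppow (/ b) z)) 0 (ppow b (t - e))) (at_right 0) (locally l) ->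
  is_RL_integral b f t (l / (b * Gamma b)).
Proof.
intros Hb HGam Ht Hf Hl.
assert (Hib : 0 < / b) by now apply Rinv_0_lt_compat.
set (phi z := f (t - ppow (/ b) z)) in *.
assert (Hphi : forall z, z < ppow b t -> continuous phi z).
{ intros z Hz. apply (continuous_comp (fun z => t - ppow (/ b) z) f).
  apply continuous_const_sub. now apply continuous_ppow.
  apply Hf. apply Rlt_0_minus.
  destruct (Rle_lt_dec z 0). rewrite ppow_nonpos; lra.
  destruct (Rle_lt_dec t (ppow (/ b) z)) as [H|H]; [|easy].
  assert (ppow b t <= ppow b (ppow (/ b) z)) by (apply ppow_le; lra).
  rewrite ppow_inv_r in H0; lra. }
assert (Hex : forall x y, x < ppow b t -> y < ppow b t -> ex_RInt phi x y).
{ intros x y Hx Hy. apply @ex_RInt_continuous. intros z Hz. apply Hphi.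
  revert Hz. unfold Rmax; destruct (Rle_dec x y); lra. }
assert (HPt : forall a, 0 < a -> ppow b (t - a) < ppow b t).
{ intros a Ha. destruct (Rle_lt_dec (t - a) 0).
  rewrite ppow_nonpos by easy. now apply ppow_gt0.
  rewrite !ppow_Rpower by lra. apply Rlt_Rpower_l; lra. }
assert (Hpt := ppow_gt0 b t Ht).
set (J Z := RInt phi 0 Z).
set (K := / (b * Gamma b)).
(* The primitive in s is -K J((t - s)^b): it tends to -K J(0) = 0 at s = t and to -K l at s = 0. *)
replace (l / (b * Gamma b)) with (- K * J (ppow b (t - t)) - - K * l).
2:{ rewrite Rminus_diag, ppow_nonpos by lra. unfold J. rewrite (RInt_point (V := R_CompleteNormedModule)).
    unfold zero; simpl. unfold K. field. lra. }
unfold is_RL_integral.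
apply (is_RInt_gen_sub _ (fun c => - K * J (ppow b (t - c))) (fun a => - K * J (ppow b (t - a)))).
- apply Filter_prod with (Q := fun x => 0 < x < t) (R := fun x => 0 < x < t).
  + exists (mkposreal t Ht). intros y Hy Hy0. change (Rabs (y - 0) < t) in Hy.
    apply Rabs_def2 in Hy. lra.
  + exists (mkposreal t Ht). intros y Hy Hy0. change (Rabs (y - t) < t) in Hy.
    apply Rabs_def2 in Hy. lra.
  + intros a c Ha Hc. unfold fst, snd.
    apply (is_RInt_ext (fun s => scal (/ Gamma b) (Rpower (t - s) (b - 1) * f s))).
    { intros s _. unfold omega, scal; simpl; unfold mult; simpl. field. lra. }
    assert (HCh := RInt_Chasles (V := R_CompleteNormedModule) phi 0 (ppow b (t - c)) (ppow b (t - a))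
       (Hex _ _ Hpt (HPt c ltac:(lra))) (Hex _ _ (HPt c ltac:(lra)) (HPt a ltac:(lra)))).
    change plus with Rplus in HCh. fold (J (ppow b (t - c))) (J (ppow b (t - a))) in HCh.
    replace (- K * J (ppow b (t - c)) - - K * J (ppow b (t - a))) with (scal (/ Gamma b) (/ b * RInt phi (ppow b (t - c)) (ppow b (t - a)))).
    2:{ unfold scal; simpl; unfold mult; simpl.
        replace (RInt phi (ppow b (t - c)) (ppow b (t - a))) with (J (ppow b (t - a)) - J (ppow b (t - c))) by lra.
        unfold K. field. lra. }
    apply (is_RInt_scal (V := R_NormedModule)).
    apply is_RInt_RL_kernel; try lra.
    intros x Hx. apply Hf. revert Hx; unfold Rmin, Rmax; destruct (Rle_dec a c); lra.
- eapply filterlim_comp; [|apply (filterlim_scal_r (V := R_NormedModule))].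
  apply (filterlim_filter_le_1 (F := locally t)); [apply filter_le_within|].
  apply (continuous_comp (fun c => ppow b (t - c)) J).
  + apply (continuous_comp (fun c => t - c)); [|now apply continuous_ppow].
    apply continuous_const_sub. apply continuous_id.
  + rewrite Rminus_diag, ppow_nonpos by lra.
    apply @ex_derive_continuous. exists (phi 0).
    apply (is_derive_RInt phi J 0 0); auto.
    exists (mkposreal _ Hpt). intros y Hy. change (Rabs (y - 0) < ppow b t) in Hy.
    apply Rabs_def2 in Hy.
    apply (RInt_correct (V := R_CompleteNormedModule)). apply Hex; lra.
- eapply filterlim_comp; [|apply (filterlim_scal_r (V := R_NormedModule))]. exact Hl.
Qed.

(* b * Gamma b times the Riemann-Liouville integral of order b, see
   is_RL_integral_RLint. *)
Definition RLint (b : R) (h : R -> R) (t : R) : R :=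
  RInt (fun z => h (t - ppow (/ b) z)) 0 (ppow b t).

(** The regularity of an extension of u': dh, in the role of u'', may blow up at 0. Continuity of h
    on all of R makes its integrals exist without tracking domains. *)
Definition C1_pos (h dh : R -> R) : Prop :=
  (forall x, continuous h x) /\ (forall x, 0 < x -> is_derive h x (dh x)) /\
  (forall x, 0 < x -> continuous dh x).

Lemma continuous_RLint_trunc (b c : R) (h : R -> R) (t : R) : 0 < b -> (forall x, continuous h x) ->
  continuous (fun t => RInt (fun z => h (t - ppow (/ b) z)) 0 (ppow b (t - c))) t.
Proof.
intros Hb Hh.
apply (continuous_ext (fun y => RInt (fun z => h (- (- y + ppow (/ b) z))) 0 (ppow b (y - c)))).
{ intro y. apply RInt_ext. intros x _. f_equal. ring. }
apply (continuous_RInt_ppow (fun s => h (- s)) b (fun y => y - c) Ropp); auto.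
- intro x. apply (continuous_comp Ropp h); auto. apply (continuous_opp (V := R_NormedModule)), continuous_id.
- intro x. apply (continuous_minus (fun y : R => y)). apply continuous_id. apply continuous_const.
- intro x. apply (continuous_opp (V := R_NormedModule)), continuous_id.
Qed.

Lemma continuous_RLint (b : R) (h : R -> R) (t : R) : 0 < b -> (forall x, continuous h x) ->
  continuous (RLint b h) t.
Proof.
intros Hb Hh.
apply (continuous_ext (fun t => RInt (fun z => h (t - ppow (/ b) z)) 0 (ppow b (t - 0)))).
{ intro y. now rewrite Rminus_0_r. }
now apply continuous_RLint_trunc.
Qed.

(** On [0, c] with c < t the kernel stays away from its singularity, so the derivative can fall on
    it for any exponent while h is merely continuous. *)
Lemma is_derive_smooth_kernel (p : R) (h : R -> R) (c t : R) :
  0 < c < t -> (forall x, continuous h x) ->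
  is_derive (fun t => RInt (fun s => Rpower (t - s) p * h s) 0 c) t
    (p * RInt (fun s => Rpower (t - s) (p - 1) * h s) 0 c).
Proof.
intros Hc Hh.
assert (HD : forall u v, 0 < u - v -> is_derive (fun z => Rpower (z - v) p * h v) u (p * Rpower (u - v) (p - 1) * h v)).
{ intros u v Huv.
  apply (is_derive_ext (fun z => h v * Rpower (z - v) p)). { intro; apply Rmult_comm. }
  rewrite Rmult_comm.
  apply (is_derive_scal (fun z => Rpower (z - v) p)).
  rewrite <- (Rmult_1_l (p * _)).
  apply (is_derive_comp (V := R_NormedModule) (fun x => Rpower x p) (fun z => z - v)).
  - apply is_derive_Reals. apply derivable_pt_lim_power. easy.
  - auto_derive; [easy|ring]. }
assert (Hcont : forall q u v, 0 < u - v -> continuity_2d_pt (fun u v => Rpower (u - v) q * h v) u v).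
{ intros q u v Huv. apply continuity_2d_pt_filterlim.
  apply (continuous_mult (fun z : R * R => Rpower (fst z - snd z) q) (fun z : R * R => h (snd z)) (u, v)).
  - apply (continuous_comp (fun z : R * R => fst z - snd z) (fun x => Rpower x q)).
    apply (continuous_minus (V := R_NormedModule) (fun z : R * R => fst z)). apply continuous_fst. apply continuous_snd.
    now apply continuous_Rpower.
  - apply (continuous_comp snd h); auto. apply continuous_snd. }
assert (Hmm : Rmin 0 c = 0 /\ Rmax 0 c = c) by (split; [apply Rmin_left|apply Rmax_right]; lra).
assert (HI : forall q y, c < y -> ex_RInt (fun s => Rpower (y - s) q * h s) 0 c).
{ intros q y Hy. apply @ex_RInt_continuous. rewrite (proj1 Hmm), (proj2 Hmm). intros z Hz.
  apply (continuous_mult (fun s => Rpower (y - s) q) h); auto.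
  apply (continuous_comp (fun s => y - s) (fun x => Rpower x q)).
  apply continuous_const_sub. apply continuous_id.
  apply continuous_Rpower. lra. }
assert (Hnear : locally t (fun y : R => c < y)).
{ exists (mkposreal (t - c) ltac:(lra)). intros y Hy. change (Rabs (y - t) < t - c) in Hy.
  apply Rabs_def2 in Hy. lra. }
replace (p * _) with (RInt (fun s => Derive (fun t => Rpower (t - s) p * h s) t) 0 c).
2:{ symmetry. etransitivity; [symmetry; apply (RInt_scal (V := R_CompleteNormedModule) _ _ _ p); apply HI; lra|].
    apply RInt_ext. rewrite (proj1 Hmm), (proj2 Hmm). intros s Hs. symmetry.
    apply is_derive_unique. unfold scal; simpl; unfold mult; simpl.
    rewrite <- Rmult_assoc. apply HD. lra. }
apply (is_derive_RInt_param (fun t s => Rpower (t - s) p * h s)); rewrite ?(proj1 Hmm), ?(proj2 Hmm).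
- revert Hnear. apply filter_imp. intros y Hy s Hs. eexists. apply HD. lra.
- intros s Hs. apply (continuity_2d_pt_ext_loc (fun u v => p * (Rpower (u - v) (p - 1) * h v))).
  + exists (mkposreal ((t - s) / 2) ltac:(lra)). simpl. intros u v Hu Hv.
    apply Rabs_def2 in Hu, Hv. symmetry. rewrite <- Rmult_assoc. apply is_derive_unique. apply HD. lra.
  + apply continuity_2d_pt_mult. apply continuity_2d_pt_const. apply Hcont. lra.
- revert Hnear. apply filter_imp. intros y Hy. now apply HI.
Qed.

(* The upper bound z = (t - c)^b means that only h on [c, t] matters, so that h
   may be replaced by an extension that is C^1 on R. *)
Lemma is_derive_RLint_trunc (b c : R) (h dh : R -> R) (t : R) :
  0 < b -> c < t -> (forall x, is_derive h x (dh x)) -> (forall x, continuous dh x) ->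
  is_derive (fun t => RInt (fun z => h (t - ppow (/ b) z)) 0 (ppow b (t - c))) t
    (RInt (fun z => dh (t - ppow (/ b) z)) 0 (ppow b (t - c)) + h c * (b * Rpower (t - c) (b - 1))).
Proof.
intros Hb Hct Hh Hdh.
assert (Hib : 0 < / b) by now apply Rinv_0_lt_compat.
assert (Hhc : forall x, continuous h x) by (intro; apply @ex_derive_continuous; eexists; apply Hh).
assert (HD : forall u v, is_derive (fun z => h (z - ppow (/ b) v)) u (dh (u - ppow (/ b) v))).
{ intros u v. rewrite <- (Rmult_1_l (dh _)).
  apply (is_derive_comp (V := R_NormedModule) h (fun z => z - ppow (/ b) v)). apply Hh.
  auto_derive; [easy|ring]. }
assert (Hsub : forall u v : R, continuous (fun v => u - ppow (/ b) v) v).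
{ intros u v. apply continuous_const_sub. now apply continuous_ppow. }
assert (HI : forall y x z, ex_RInt (fun v => h (y - ppow (/ b) v)) x z).
{ intros. apply @ex_RInt_continuous. intros v _. apply (continuous_comp (fun v => y - ppow (/ b) v) h); auto. }
assert (Hcont : forall u v, continuity_2d_pt (fun u v => Derive (fun z => h (z - ppow (/ b) v)) u) u v).
{ intros u v. apply (continuity_2d_pt_ext (fun u v => dh (u - ppow (/ b) v))).
  { intros x y. symmetry. apply is_derive_unique, HD. }
  apply continuity_2d_pt_filterlim.
  apply (continuous_comp (fun z : R * R => fst z - ppow (/ b) (snd z)) dh (u, v)); auto.
  apply (continuous_minus (V := R_NormedModule) (fun z : R * R => fst z)). apply continuous_fst.
  apply (continuous_comp snd (ppow (/ b))). apply continuous_snd. now apply continuous_ppow. }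
replace (h c) with (h (t - ppow (/ b) (ppow b (t - c)))).
2:{ f_equal. rewrite ppow_inv_l by lra. ring. }
rewrite (RInt_ext (fun z => dh (t - ppow (/ b) z)) (fun z => Derive (fun u => h (u - ppow (/ b) z)) t)).
2:{ intros z _. symmetry. apply is_derive_unique, HD. }
apply (is_derive_RInt_param_bound_comp_aux3 (fun t z => h (t - ppow (/ b) z)) 0 (fun t => ppow b (t - c))).
- now apply filter_forall.
- exists (mkposreal 1 Rlt_0_1). now apply filter_forall.
- rewrite <- (Rmult_1_l (b * _)).
  apply (is_derive_comp (V := R_NormedModule) (ppow b) (fun t => t - c)).
  apply is_derive_ppow; lra. auto_derive; [easy|ring].
- exists (mkposreal 1 Rlt_0_1). apply filter_forall. intros y v _. eexists. apply HD.
- auto.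
- exists (mkposreal 1 Rlt_0_1). auto.
- apply continuity_pt_filterlim. apply (continuous_comp (fun v => t - ppow (/ b) v) h); auto.
Qed.

(** The integral is cut at some c in (0, t). On [c, t] the substitution lets the derivative fall on
    h, which is C^1 there; on [0, c] it falls on the smooth kernel. Integrating by parts on [e, c]
    and letting e tend to 0 moves it back onto h and leaves the boundary term at 0. *)
Lemma C1_pos_RLint (b : R) (h dh : R -> R) : 0 < b -> C1_pos h dh ->
  exists d, C1_pos (RLint b h) d /\ forall t, 0 < t ->
    filterlim (fun e => RInt (fun z => dh (t - ppow (/ b) z)) 0 (ppow b (t - e)))
      (at_right 0) (locally (d t - h 0 * (b * Rpower t (b - 1)))).
Proof.
intros Hb (Hh & Hd & Hdc).
assert (Hib : 0 < / b) by now apply Rinv_0_lt_compat.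
(* [dhc c] freezes h' to the left of c, and its primitive [hc c] is C^1 on R and equals h on [c,
   +oo). *)
set (dhc c s := dh (Rmax c s)).
set (hc c s := h c + RInt (dhc c) c s).
assert (Cdhc : forall c x, 0 < c -> continuous (dhc c) x).
{ intros c x Hc. apply (continuous_comp (Rmax c) dh).
  - apply continuous_Rmax.
  - apply Hdc. assert (c <= Rmax c x) by apply Rmax_l. lra. }
assert (Dhc : forall c x, 0 < c -> is_derive (hc c) x (dhc c x)).
{ intros c x Hc. unfold hc. replace (dhc c x) with (plus zero (dhc c x)) by apply plus_zero_l.
  apply (is_derive_plus (V := R_NormedModule) (fun _ => h c)). apply (is_derive_const (V := R_NormedModule)).
  apply (is_derive_RInt (dhc c) _ c); auto. apply filter_forall. intro y.
  apply (RInt_correct (V := R_CompleteNormedModule)). apply @ex_RInt_continuous; auto. }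
assert (Ehc : forall c s, 0 < c -> c <= s -> hc c s = h s).
{ intros c s Hc Hs. unfold hc.
  assert (H : is_RInt dh c s (minus (h s) (h c))).
  { apply (is_RInt_derive h dh); intros x Hx; rewrite Rmin_left in Hx by easy; [apply Hd|apply Hdc]; lra. }
  rewrite (RInt_ext _ dh).
  - rewrite (is_RInt_unique _ _ _ _ H). unfold minus, plus, opp; simpl. ring.
  - intros x Hx. rewrite Rmin_left in Hx by easy. unfold dhc. rewrite Rmax_right; lra. }
set (A p c t := RInt (fun s => Rpower (t - s) p * h s) 0 c : R).
(* The first two terms differentiate the part on [c, t] with its moving limit, the last one the
   kernel on [0, c]. *)
set (D c t := RInt (fun z => dhc c (t - ppow (/ b) z)) 0 (ppow b (t - c))
   + hc c c * (b * Rpower (t - c) (b - 1)) + b * ((b - 1) * A (b - 1 - 1) c t)).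
assert (Hnear : forall c t, c < t -> locally t (fun y : R => c < y)).
{ intros c t Hc. exists (mkposreal (t - c) ltac:(lra)). intros y Hy. change (Rabs (y - t) < t - c) in Hy.
  apply Rabs_def2 in Hy. lra. }
assert (Hrange : forall c t z, c < t -> 0 <= z <= ppow b (t - c) -> c <= t - ppow (/ b) z).
{ intros c t z Hct Hz. assert (ppow (/ b) z <= ppow (/ b) (ppow b (t - c))) by (apply ppow_le; lra).
  rewrite ppow_inv_l in H; lra. }
assert (Hphi : forall (f : R -> R) (c t : R), c < t -> (forall x, c <= x -> continuous f x) ->
   forall z, 0 <= z <= ppow b (t - c) -> continuous (fun z => f (t - ppow (/ b) z)) z).
{ intros f c t Hct Hf z Hz. apply (continuous_comp (fun z => t - ppow (/ b) z) f).
  - apply continuous_const_sub. now apply continuous_ppow.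
  - apply Hf. now apply Hrange. }
assert (Hpow : forall p u v, 0 < u - v -> continuous (fun v => Rpower (u - v) p) v).
{ intros p u v Huv. apply (continuous_comp (fun v => u - v) (fun x => Rpower x p)).
  apply continuous_const_sub. apply continuous_id.
  now apply continuous_Rpower. }
assert (Hsplit : forall (f : R -> R) (c e t : R), 0 <= e <= c -> c < t -> (forall x, e <= x -> continuous f x) ->
   RInt (fun z => f (t - ppow (/ b) z)) 0 (ppow b (t - e)) =
   RInt (fun z => f (t - ppow (/ b) z)) 0 (ppow b (t - c)) +
   b * RInt (fun s => Rpower (t - s) (b - 1) * f s) e c).
{ intros f c e t He Hct Hf.
  assert (Hk := is_RInt_RL_kernel b f t e c Hb ltac:(lra) Hct).
  specialize (Hk ltac:(intros x Hx; apply Hf; rewrite Rmin_left in Hx; lra)).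
  rewrite (is_RInt_unique _ _ _ _ Hk).
  rewrite <- Rmult_assoc, Rinv_r, Rmult_1_l by lra.
  assert (ppow b (t - c) <= ppow b (t - e)) by (apply ppow_le; lra).
  assert (0 <= ppow b (t - c)) by apply ppow_ge0.
  symmetry. apply (RInt_Chasles (V := R_CompleteNormedModule)); apply @ex_RInt_continuous; intros z Hz;
    rewrite Rmin_left, Rmax_right in Hz by lra; apply (Hphi f e); auto; lra. }
assert (HD : forall c t, 0 < c < t -> is_derive (RLint b h) t (D c t)).
{ intros c t Hc.
  apply (is_derive_ext_loc (fun t => RInt (fun z => hc c (t - ppow (/ b) z)) 0 (ppow b (t - c)) + b * A (b - 1) c t)).
  - generalize (Hnear c t (proj2 Hc)). apply filter_imp. intros y Hy. unfold RLint.
    replace (ppow b y) with (ppow b (y - 0)) by (f_equal; ring).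
    rewrite (Hsplit h c 0 y) by (auto; lra). f_equal.
    apply RInt_ext. intros z Hz. rewrite Rmin_left, Rmax_right in Hz by apply ppow_ge0.
    apply Ehc; [lra|]. apply Hrange; lra.
  - apply (is_derive_plus (V := R_NormedModule)).
    + apply is_derive_RLint_trunc; try lra; intro; [apply Dhc|apply Cdhc]; lra.
    + apply (is_derive_scal (A (b - 1) c)). now apply is_derive_smooth_kernel. }
assert (CD : forall c t, 0 < c < t -> continuous (D c) t).
{ intros c t Hc. apply (continuous_plus (V := R_NormedModule)); [apply (continuous_plus (V := R_NormedModule))|].
  - apply continuous_RLint_trunc; auto. intro; now apply Cdhc.
  - apply (continuous_mult (fun _ => hc c c)). apply continuous_const.
    apply (continuous_mult (fun _ => b)). apply continuous_const.
    apply (continuous_comp (fun t => t - c) (fun x => Rpower x (b - 1))).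
    apply (continuous_minus (fun y : R => y)). apply continuous_id. apply continuous_const.
    apply continuous_Rpower; lra.
  - apply (continuous_mult (fun _ => b)). apply continuous_const.
    apply (continuous_mult (fun _ => b - 1)). apply continuous_const.
    apply @ex_derive_continuous. eexists. now apply is_derive_smooth_kernel. }
(* By uniqueness of the derivative D c t does not depend on c, so each later use picks a convenient
   c. *)
exists (Derive (RLint b h)).
assert (HDe : forall c t, 0 < c < t -> Derive (RLint b h) t = D c t).
{ intros c t Hc. apply is_derive_unique. now apply HD. }
split; [split; [|split]|].
- intro x. now apply continuous_RLint.
- intros x Hx. rewrite (HDe (x / 2)) by lra. apply HD; lra.
- intros x Hx. apply (continuous_ext_loc _ (D (x / 2))).
  + generalize (Hnear (x / 2) x ltac:(lra)). apply filter_imp. intros y Hy. symmetry. apply HDe. lra.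
  + apply CD; lra.
- intros t Ht. set (c := t / 2). assert (Hc : 0 < c < t) by (unfold c; lra).
  rewrite (HDe c t Hc).
  (* What the integration by parts on [e, c] leaves over: the boundary term at e and the kernel term
     on [0, e], which vanishes as e tends to 0. *)
  set (X e := h e * (b * Rpower (t - e) (b - 1)) + b * ((b - 1) * A (b - 1 - 1) e t)).
  assert (Hparts : forall e, 0 < e < c ->
    RInt (fun z => dh (t - ppow (/ b) z)) 0 (ppow b (t - e)) = D c t - X e).
  { intros e He.
    rewrite (Hsplit dh c e t) by (try lra; intros; apply Hdc; lra).
    assert (HK : forall (q : R) (f : R -> R), (forall x, e <= x -> continuous f x) -> forall x, e <= x < t -> continuous (fun s => Rpower (t - s) q * f s) x).
    { intros q f Hf x Hx. apply (continuous_mult (fun s => Rpower (t - s) q) f). apply Hpow; lra. apply Hf; lra. }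
    assert (Hex : forall (q : R) (f : R -> R), (forall x, e <= x -> continuous f x) -> ex_RInt (fun s => Rpower (t - s) q * f s) e c).
    { intros q f Hf. apply @ex_RInt_continuous. rewrite Rmin_left, Rmax_right by lra. intros x Hx. apply HK; auto; lra. }
    assert (HI : is_RInt (fun s => minus (Rpower (t - s) (b - 1) * dh s) (scal (b - 1) (Rpower (t - s) (b - 1 - 1) * h s))) e c
       (minus (Rpower (t - c) (b - 1) * h c) (Rpower (t - e) (b - 1) * h e))).
    { apply (is_RInt_derive (fun s => Rpower (t - s) (b - 1) * h s)); rewrite Rmin_left, Rmax_right by lra; intros x Hx.
      - replace (minus (Rpower (t - x) (b - 1) * dh x) _) with (plus (mult (- ((b - 1) * Rpower (t - x) (b - 1 - 1))) (h x)) (mult (Rpower (t - x) (b - 1)) (dh x))).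
        2:{ change (- ((b - 1) * Rpower (t - x) (b - 1 - 1)) * h x + Rpower (t - x) (b - 1) * dh x
              = Rpower (t - x) (b - 1) * dh x + - ((b - 1) * (Rpower (t - x) (b - 1 - 1) * h x))). ring. }
        apply (is_derive_mult (fun s => Rpower (t - s) (b - 1)) h).
        + replace (- ((b - 1) * Rpower (t - x) (b - 1 - 1))) with (scal (-1) ((b - 1) * Rpower (t - x) (b - 1 - 1))).
          2:{ unfold scal; simpl; unfold mult; simpl. ring. }
          apply (is_derive_comp (V := R_NormedModule) (fun x => Rpower x (b - 1)) (fun s => t - s)).
          apply is_derive_Reals, derivable_pt_lim_power; lra. auto_derive; [easy|ring].
        + apply Hd; lra.
        + intros; apply Rmult_comm.
      - apply (continuous_minus (V := R_NormedModule)). apply HK; try lra. intros; apply Hdc; lra.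
        apply (continuous_scal_r (b - 1) (fun s => Rpower (t - s) (b - 1 - 1) * h s)). apply HK; auto; lra. }
    apply (is_RInt_unique (V := R_CompleteNormedModule)) in HI.
    rewrite (RInt_minus (V := R_CompleteNormedModule)) in HI.
    2: apply Hex; intros; apply Hdc; lra.
    2: apply (ex_RInt_scal (V := R_NormedModule)); apply Hex; auto.
    rewrite (RInt_scal (V := R_CompleteNormedModule)) in HI by (apply Hex; auto).
    unfold minus, plus, opp, scal in HI; simpl in HI; unfold mult in HI; simpl in HI.
    assert (HA : A (b - 1 - 1) c t = A (b - 1 - 1) e t + RInt (fun s => Rpower (t - s) (b - 1 - 1) * h s) e c).
    { symmetry. apply (RInt_Chasles (V := R_CompleteNormedModule)); [|apply Hex; auto].
      apply @ex_RInt_continuous. rewrite Rmin_left, Rmax_right by lra. intros x Hx.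
      apply (continuous_mult (fun s => Rpower (t - s) _) h); auto. apply Hpow; lra. }
    unfold D, X. rewrite HA, Ehc by lra.
    rewrite (RInt_ext (fun z => dhc c (t - ppow (/ b) z)) (fun z => dh (t - ppow (/ b) z))).
    2:{ intros z Hz. rewrite Rmin_left, Rmax_right in Hz by apply ppow_ge0.
        unfold dhc. rewrite Rmax_right; auto. apply Hrange; lra. }
    set (I := RInt (fun s => Rpower (t - s) (b - 1) * dh s) e c) in *.
    replace I with (Rpower (t - c) (b - 1) * h c - Rpower (t - e) (b - 1) * h e + (b - 1) *
        RInt (fun s => Rpower (t - s) (b - 1 - 1) * h s) e c) by lra.
    match goal with |- @eq _ ?x ?y => change (@eq R x y) end. ring. }
  apply (filterlim_ext_loc (fun e => D c t - X e)).
  { exists (mkposreal c (proj1 Hc)). intros y Hy Hy0. change (Rabs (y - 0) < c) in Hy.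
    apply Rabs_def2 in Hy. symmetry. apply Hparts. lra. }
  replace (D c t - h 0 * _) with (D c t - X 0).
  2:{ unfold X, A. rewrite (RInt_point (V := R_CompleteNormedModule)), Rminus_0_r. unfold zero; simpl. ring. }
  apply (filterlim_filter_le_1 (F := locally 0)); [apply filter_le_within|].
  apply (continuous_minus (V := R_NormedModule) (fun _ => D c t) X). apply continuous_const.
  apply (continuous_plus (V := R_NormedModule)).
  + apply (continuous_mult h); auto. apply (continuous_mult (fun _ => b)). apply continuous_const. apply Hpow; lra.
  + apply (continuous_mult (fun _ => b)). apply continuous_const.
    apply (continuous_mult (fun _ => b - 1)). apply continuous_const.
    apply @ex_derive_continuous. eexists.
    apply (is_derive_RInt (fun s => Rpower (t - s) (b - 1 - 1) * h s) (fun e => A (b - 1 - 1) e t) 0 0).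
    2: apply (continuous_mult (fun s => Rpower (t - s) _) h); auto; apply Hpow; lra.
    exists (mkposreal t Ht). intros y Hy. change (Rabs (y - 0) < t) in Hy. apply Rabs_def2 in Hy.
    apply (RInt_correct (V := R_CompleteNormedModule)). apply @ex_RInt_continuous.
    intros x Hx. assert (x < t) by (revert Hx; unfold Rmax; destruct (Rle_dec 0 y); lra).
    apply (continuous_mult (fun s => Rpower (t - s) _) h); auto; apply Hpow; lra.
Qed.

(** * Semigroup law and derivatives of Riemann-Liouville integrals *)

Lemma RLint_scal (b k : R) (h : R -> R) (t : R) : 0 < b -> (forall x, continuous h x) ->
  RLint b (fun s => k * h s) t = k * RLint b h t.
Proof.
intros Hb Hh. unfold RLint.
apply (RInt_scal (V := R_CompleteNormedModule) (fun z => h (t - ppow (/ b) z))).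
apply @ex_RInt_continuous. intros z _. apply (continuous_comp (fun z => t - ppow (/ b) z) h); auto.
apply continuous_const_sub. now apply continuous_ppow, Rinv_0_lt_compat.
Qed.

Lemma RLint_RLint (b : R) (g : R -> R) (t : R) : 0 < b -> 0 <= t -> (forall x, continuous g x) ->
  RLint b (RLint b g) t = vol b * RLint (2 * b) g t.
Proof.
intros Hb Ht Hg.
transitivity (shell b (fun s => g (t - s)) t).
- apply RInt_ext. intros y _. apply RInt_ext. intros z _. f_equal. ring.
- apply (shell_eq b (fun s => g (t - s))); auto.
  intro x. apply (continuous_comp (fun s => t - s) g); auto.
  apply continuous_const_sub. apply continuous_id.
Qed.

Lemma C1_pos_scal (k : R) (h dh : R -> R) :
  C1_pos h dh -> C1_pos (fun s => k * h s) (fun s => k * dh s).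
Proof.
intros (Hh & Hd & Hc). split; [|split].
- intro x. apply (continuous_mult (fun _ => k)); auto. apply continuous_const.
- intros x Hx. apply (is_derive_scal h). auto.
- intros x Hx. apply (continuous_mult (fun _ => k)); auto. apply continuous_const.
Qed.

Lemma C1_pos_sub_const (k : R) (h dh : R -> R) :
  C1_pos h dh -> C1_pos (fun s => h s - k) dh.
Proof.
intros (Hh & Hd & Hc). split; [|split]; auto.
- intro x. apply (continuous_minus h (fun _ => k)); auto. apply continuous_const.
- intros x Hx. replace (dh x) with (minus (dh x) zero) by (unfold minus, plus, opp, zero; simpl; ring).
  apply (is_derive_minus (V := R_NormedModule) h (fun _ => k)). auto. apply (is_derive_const (V := R_NormedModule)).
Qed.

Lemma is_RL_integral_ext (b : R) (f g : R -> R) (t l : R) : 0 < t ->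
  (forall s, 0 < s < t -> f s = g s) -> is_RL_integral b f t l -> is_RL_integral b g t l.
Proof.
intros Ht Hfg. unfold is_RL_integral.
apply (is_RInt_gen_ext (V := R_NormedModule)).
apply Filter_prod with (Q := fun x => 0 < x < t) (R := fun x => 0 < x < t).
- exists (mkposreal t Ht). intros y Hy Hy0. change (Rabs (y - 0) < t) in Hy.
  apply Rabs_def2 in Hy. lra.
- exists (mkposreal t Ht). intros y Hy Hy0. change (Rabs (y - t) < t) in Hy.
  apply Rabs_def2 in Hy. lra.
- intros x y Hx Hy z. unfold fst, snd, Rmin, Rmax. destruct (Rle_dec x y); intro Hz; rewrite Hfg; auto; lra.
Qed.

Lemma is_RL_integral_unique (b : R) (f : R -> R) (t l : R) :
  is_RL_integral b f t l -> RL_integral b f t = l.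
Proof. intro H. exact (is_RInt_gen_unique (V := R_CompleteNormedModule) (Fa := at_right 0) (Fb := at_left t) _ l H). Qed.

(** For h continuous up to 0 the limit at the lower end is just continuity of a proper integral in
    its upper limit. *)
Lemma is_RL_integral_RLint (b : R) (h : R -> R) (t : R) : 0 < b <= 1 -> 0 < t ->
  (forall x, continuous h x) -> is_RL_integral b h t (RLint b h t / (b * Gamma b)).
Proof.
intros Hb Ht Hh.
apply is_RL_integral_of_lim; auto; try lra. now apply Gamma_lim.
unfold RLint. replace (ppow b t) with (ppow b (t - 0)) by (f_equal; ring).
apply (filterlim_filter_le_1 (F := locally 0)); [apply filter_le_within|].
apply (continuous_comp (fun e => ppow b (t - e)) (fun y => RInt (fun z => h (t - ppow (/ b) z)) 0 y)).
- apply (continuous_comp (fun e => t - e)).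
  apply continuous_const_sub. apply continuous_id.
  apply continuous_ppow; lra.
- apply continuous_RInt_upper. intro z. apply (continuous_comp (fun z => t - ppow (/ b) z) h); auto.
  apply continuous_const_sub. apply continuous_ppow, Rinv_0_lt_compat; lra.
Qed.

Lemma is_RL_integral_derivative (b : R) (h dh : R -> R) : 0 < b <= 1 -> C1_pos h dh ->
  exists d, C1_pos (RLint b h) d /\ forall t, 0 < t ->
    is_RL_integral b dh t (d t / (b * Gamma b) - h 0 * omega b t).
Proof.
intros Hb HC. destruct (C1_pos_RLint b h dh ltac:(lra) HC) as [d [Hd Hl]].
exists d. split; [easy|]. intros t Ht.
assert (HG : 0 < Gamma b) by now apply Gamma_lim.
replace (d t / (b * Gamma b) - h 0 * omega b t) with ((d t - h 0 * (b * Rpower t (b - 1))) / (b * Gamma b)).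
- apply is_RL_integral_of_lim; auto; try lra. apply HC.
- unfold omega. field. lra.
Qed.

(** Here V = I^b h and l = (I^(2b) h)'(t). Since V(0) = 0, I^b V' = (I^b V)' carries no boundary
    term, whereas I^(2b) h' loses h(0) omega_(2b). *)
Lemma is_RL_integral_RL_integral_derivative (b : R) (h dh : R -> R) : 0 < b -> 2 * b <= 1 -> C1_pos h dh ->
  exists V dV, C1_pos V dV /\ (forall t, 0 < t -> is_RL_integral b h t (V t)) /\
   forall t, 0 < t -> exists l,
    is_RL_integral b dV t l /\ is_RL_integral (2 * b) dh t (l - h 0 * omega (2 * b) t).
Proof.
intros Hb Hb2 HC.
assert (HG : 0 < Gamma b) by (apply Gamma_lim; lra).
assert (HG2 : 0 < Gamma (2 * b)) by (apply Gamma_lim; lra).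
assert (Hh := proj1 HC).
destruct (is_RL_integral_derivative b h dh ltac:(lra) HC) as [d1 [Hd1 _]].
destruct (is_RL_integral_derivative (2 * b) h dh ltac:(lra) HC) as [d3 [Hd3 Hl3]].
set (k := / (b * Gamma b)).
assert (HV := C1_pos_scal k _ _ Hd1).
destruct (is_RL_integral_derivative b _ _ ltac:(lra) HV) as [d2 [Hd2 Hl2]].
exists (fun s => k * RLint b h s), (fun s => k * d1 s). split; [easy|split].
- intros t Ht. rewrite (Rmult_comm k). apply is_RL_integral_RLint; auto; lra.
- intros t Ht. exists (d3 t / (2 * b * Gamma (2 * b))). split; [|now apply Hl3].
  replace (d3 t / _) with (d2 t / (b * Gamma b) - k * RLint b h 0 * omega b t); [now apply Hl2|].
  replace (RLint b h 0) with 0.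
  2:{ unfold RLint. rewrite ppow_nonpos by lra. symmetry. apply (RInt_point (V := R_CompleteNormedModule)). }
  (* Both sides are derivatives of one function by the semigroup law; [vol_Gamma] then cancels the
     two factors 1 / (b Gamma(b)). *)
  assert (E2 : d2 t = k * vol b * d3 t).
  { assert (D2 := proj1 (proj2 Hd2) t Ht).
    rewrite <- (is_derive_unique _ _ _ D2). apply is_derive_unique.
    apply (is_derive_ext_loc (fun t => k * vol b * RLint (2 * b) h t)).
    - exists (mkposreal t Ht). intros y Hy. change (Rabs (y - t) < t) in Hy. apply Rabs_def2 in Hy.
      rewrite RLint_scal by (auto; intro; now apply continuous_RLint). rewrite RLint_RLint by (auto; lra).
      apply Rmult_assoc.
    - apply (is_derive_scal (RLint (2 * b) h)). now apply Hd3. }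
  rewrite E2. assert (HvG := vol_Gamma b Hb Hb2).
  replace (vol b) with ((b * Gamma b) ^ 2 / (2 * b * Gamma (2 * b))) by (rewrite <- HvG; field; lra).
  unfold k. field. lra.
Qed.

(** * Caputo derivatives *)

Lemma caputo_order_eq (d : R) (n : nat) : INR n < d + 1 -> d < INR n -> caputo_order d = n.
Proof.
intros H1 H2. unfold caputo_order.
rewrite <- (tech_up d (Z.of_nat n)); rewrite <- ?INR_IZR_INZ; try lra. apply Nat2Z.id.
Qed.

(** The integrals at t see only (0, t), so t = T is allowed although g is u' only on (0, T). The
    value is also expressed through dg alone, so that functions with the same second derivative can
    be compared. *)
Lemma Caputo_split (T alpha : R) (u g dg : R -> R) :
  1 < alpha < 2 -> C1_pos g dg -> (forall s, 0 < s < T -> is_derive u s (g s)) ->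
  forall t, 0 < t <= T ->
  ex_Caputo alpha u t /\ ex_Caputo (alpha / 2) u t /\
  ex_Caputo (alpha / 2) (Caputo (alpha / 2) u) t /\
  Caputo alpha u t = RL_integral (2 - alpha) dg t /\
  Caputo alpha u t = Caputo (alpha / 2) (Caputo (alpha / 2) u) t - g 0 * omega (2 - alpha) t.
Proof.
intros Ha HC Hu t Ht.
set (b := 1 - alpha / 2). assert (Hb : 0 < b /\ 2 * b <= 1) by (unfold b; lra).
destruct (is_RL_integral_RL_integral_derivative b g dg (proj1 Hb) (proj2 Hb) HC) as (V & dV & HV & HV1 & HV2).
assert (O2 : caputo_order alpha = 2%nat) by (apply caputo_order_eq; simpl; lra).
assert (O1 : caputo_order (alpha / 2) = 1%nat) by (apply caputo_order_eq; simpl; lra).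
(* The hypothesis on u covers (0, T) only, so derivatives are transferred on neighbourhoods inside
   that interval. *)
assert (Hloc : forall s, 0 < s < T -> locally s (fun y => 0 < y < T)).
{ intros s Hs. apply filter_and. now apply (open_gt 0). now apply (open_lt T). }
assert (D1 : forall s, 0 < s < T -> Derive u s = g s).
{ intros s Hs. apply is_derive_unique. auto. }
assert (D2 : forall s, 0 < s < T -> is_derive (Derive u) s (dg s)).
{ intros s Hs. apply (is_derive_ext_loc g); [|apply HC; lra].
  generalize (Hloc s Hs). apply filter_imp. intros y Hy. symmetry. auto. }
assert (R1 : forall s, 0 < s <= T -> is_RL_integral b (Derive_n u 1) s (V s)).
{ intros s Hs. apply (is_RL_integral_ext b g); [lra| |apply HV1; lra].
  intros y Hy. symmetry. apply D1; lra. }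
assert (C1 : forall s, 0 < s <= T -> Caputo (alpha / 2) u s = V s).
{ intros s Hs. unfold Caputo. rewrite O1. simpl INR. now apply is_RL_integral_unique, R1. }
assert (D3 : forall s, 0 < s < T -> is_derive (Caputo (alpha / 2) u) s (dV s)).
{ intros s Hs. apply (is_derive_ext_loc V); [|apply HV; lra].
  generalize (Hloc s Hs). apply filter_imp. intros y Hy. symmetry. apply C1; lra. }
destruct (HV2 t (proj1 Ht)) as [l [L1 L2]].
replace (2 * b) with (2 - alpha) in L2 by (unfold b; lra).
assert (R2 : is_RL_integral (INR 2 - alpha) (Derive_n u 2) t (l - g 0 * omega (2 - alpha) t)).
{ simpl INR. replace (1 + 1 - alpha) with (2 - alpha) by ring.
  apply (is_RL_integral_ext _ dg); [lra| |exact L2].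
  intros s Hs. symmetry. apply is_derive_unique, D2; lra. }
assert (R3 : is_RL_integral b (Derive_n (Caputo (alpha / 2) u) 1) t l).
{ apply (is_RL_integral_ext b dV); [lra| |exact L1].
  intros s Hs. symmetry. apply is_derive_unique, D3; lra. }
split; [|split; [|split; [|split]]].
- unfold ex_Caputo. rewrite O2. split; [|eexists; exact R2].
  intros [|[|[|k]]] s Hk Hs; [exact I| | |lia].
  + exists (g s). apply Hu; lra.
  + exists (dg s). apply D2; lra.
- unfold ex_Caputo. rewrite O1. split; [|exists (V t); now apply R1].
  intros [|[|k]] s Hk Hs; [exact I| |lia].
  exists (g s). apply Hu; lra.
- unfold ex_Caputo. rewrite O1. split; [|exists l; exact R3].
  intros [|[|k]] s Hk Hs; [exact I| |lia].
  exists (dV s). apply D3; lra.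
- unfold Caputo. rewrite O2. rewrite (is_RL_integral_unique _ _ _ _ R2).
  symmetry. now apply is_RL_integral_unique.
- unfold Caputo at 1. rewrite O2. rewrite (is_RL_integral_unique _ _ _ _ R2).
  unfold Caputo at 1. rewrite O1. simpl INR. fold b. now rewrite (is_RL_integral_unique _ _ _ _ R3).
Qed.

(** * Extension of u' from [0, T] to the real line, and the theorem *)

Lemma D_in_is_derive (f f' : R -> R) (D : R -> Prop) (x : R) :
  locally x D -> D_in f f' D x -> is_derive f x (f' x).
Proof.
intros [d Hd] Hf. apply is_derive_Reals. intros eps Heps.
destruct (Hf eps Heps) as [a [Ha H]].
assert (Hm : 0 < Rmin a d) by (apply Rmin_pos; [lra|apply cond_pos]).
exists (mkposreal _ Hm). simpl. intros h Hh0 Hh.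
assert (Rabs h < a) by (eapply Rlt_le_trans; [exact Hh|apply Rmin_l]).
assert (Rabs h < d) by (eapply Rlt_le_trans; [exact Hh|apply Rmin_r]).
specialize (H (x + h)). simpl in H. unfold R_dist in H.
replace (x + h - x) with h in H by ring. apply H.
split; [split|easy].
- apply Hd. change (Rabs (x + h - x) < d). now replace (x + h - x) with h by ring.
- lra.
Qed.

(** Clamping at T turns one-sided continuity at that end into continuity on both sides. *)
Lemma continuous_comp_Rmin (f : R -> R) (D : R -> Prop) (T x : R) :
  (forall y, D y -> continue_in f D y) -> locally x (fun y => D (Rmin y T)) ->
  continuous (fun y => f (Rmin y T)) x.
Proof.
intros Hf [d Hd]. apply continuity_pt_filterlim. intros eps Heps.
assert (Dx : D (Rmin x T)) by (apply Hd, ball_center).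
destruct (Hf _ Dx eps Heps) as [a [Ha H]].
exists (Rmin a d). split; [apply Rmin_pos; [lra|apply cond_pos]|].
intros y [_ Hy]. simpl in *. unfold R_dist in *.
assert (Hya : Rabs (y - x) < a) by (eapply Rlt_le_trans; [exact Hy|apply Rmin_l]).
assert (Hyd : Rabs (y - x) < d) by (eapply Rlt_le_trans; [exact Hy|apply Rmin_r]).
(* [continue_in] speaks of distinct points only, so coinciding clamped values are treated apart. *)
destruct (Req_dec (Rmin x T) (Rmin y T)) as [<-|Hne].
- now rewrite Rminus_diag, Rabs_R0.
- apply H. split; [split; [now apply Hd|easy]|].
  revert Hya. unfold Rmin, Rabs. destruct (Rle_dec y T), (Rle_dec x T), (Rcase_abs (y - x));
  try match goal with |- context [Rcase_abs ?z] => destruct (Rcase_abs z) end; lra.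
Qed.

(** Beyond T, u'' is frozen at its value at T and integrated; left of 0, u' is frozen at u'(0).
    Uniqueness of derivatives reconciles the separate witnesses coming from [0, T], (0, T] and the
    point 0. *)
Lemma C1_pos_extension (T du0 : R) (u : R -> R) :
  0 < T -> C_class 1 (fun x => 0 <= x <= T) u -> C_class 2 (fun x => 0 < x <= T) u ->
  D_in u (fun _ => du0) (fun x => 0 <= x <= T) 0 ->
  exists g dg, C1_pos g dg /\ (forall s, 0 < s < T -> is_derive u s (g s)) /\ g 0 = du0.
Proof.
intros HT [u1 [Hu1 Cu1]] [w1 [Hw1 [w2 [Hw2 Cw2]]]] H0. simpl in Cu1, Cw2.
assert (E0 : u1 0 = du0).
{ apply (single_limit (fun x => (u x - u 0) / (x - 0)) (D_x (fun x => 0 <= x <= T) 0) _ _ 0).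
  - intros a Ha. assert (0 < Rmin a T) by (apply Rmin_pos; lra).
    assert (Rmin a T <= a) by apply Rmin_l. assert (Rmin a T <= T) by apply Rmin_r.
    (* A point of [0, T] other than 0 and within a of it: 0 is an accumulation point, so the
       one-sided derivative is unique. *)
    exists (Rmin a T / 2). split; [split; [lra|lra]|].
    unfold R_dist. rewrite Rabs_pos_eq; lra.
  - apply Hu1; lra.
  - exact H0. }
assert (Hloc : forall s, 0 < s < T -> locally s (fun y => 0 < y < T)).
{ intros s Hs. apply filter_and. now apply (open_gt 0). now apply (open_lt T). }
assert (Du : forall s, 0 < s < T -> is_derive u s (w1 s)).
{ intros s Hs. apply (D_in_is_derive u w1 (fun x => 0 < x <= T)); [|apply Hw1; lra].
  generalize (Hloc s Hs). apply filter_imp. intros; lra. }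
assert (E1 : forall s, 0 < s < T -> w1 s = u1 s).
{ intros s Hs. rewrite <- (is_derive_unique _ _ _ (Du s Hs)). apply is_derive_unique.
  apply (D_in_is_derive u u1 (fun x => 0 <= x <= T)); [|apply Hu1; lra].
  generalize (Hloc s Hs). apply filter_imp. intros; lra. }
set (dg s := w2 (Rmin s T)).
assert (Hmin : forall x, 0 < x -> locally x (fun y => 0 < Rmin y T <= T)).
{ intros x Hx. generalize (open_gt 0 x Hx). apply filter_imp. intros y Hy.
  split; [now apply Rmin_pos|apply Rmin_r]. }
assert (Cdg : forall x, 0 < x -> continuous dg x).
{ intros x Hx. apply (continuous_comp_Rmin w2 (fun x => 0 < x <= T)); auto. }
assert (Dw : forall s, 0 < s < T -> is_derive w1 s (dg s)).
{ intros s Hs. unfold dg. rewrite Rmin_left by lra. apply (D_in_is_derive w1 w2 (fun x => 0 < x <= T)); [|apply Hw2; lra].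
  generalize (Hloc s Hs). apply filter_imp. intros; lra. }
(* The primitive is anchored at T because [dg] need not be integrable near 0. *)
set (G s := w1 T + RInt dg T s).
assert (DG : forall s, 0 < s -> is_derive G s (dg s)).
{ intros s Hs. unfold G. replace (dg s) with (plus zero (dg s)) by apply plus_zero_l.
  apply (is_derive_plus (V := R_NormedModule) (fun _ => w1 T)). apply (is_derive_const (V := R_NormedModule)).
  apply (is_derive_RInt dg _ T); auto.
  generalize (open_gt 0 s Hs). apply filter_imp. intros y Hy.
  apply (RInt_correct (V := R_CompleteNormedModule)). apply @ex_RInt_continuous.
  intros z Hz. apply Cdg. revert Hz. unfold Rmin; destruct (Rle_dec T y); lra. }
assert (EG : forall s, 0 < s < T -> G s = w1 s).
{ intros s Hs.
  (* This difference has zero derivative on (s, T) and vanishes at T; the clamp supplies the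
     two-sided continuity required at T. *)
  destruct (MVT_gen (fun x => w1 (Rmin x T) - G x) s T (fun _ => 0)) as [c [_ Hc]].
  - rewrite Rmin_left, Rmax_right by lra. intros x Hx.
    replace 0 with (minus (dg x) (dg x)) by apply Rminus_diag.
    apply (is_derive_minus (V := R_NormedModule) (fun x => w1 (Rmin x T)) G); [|apply DG; lra].
    apply (is_derive_ext_loc w1); [|apply Dw; lra].
    generalize (Hloc x ltac:(lra)). apply filter_imp. intros y Hy. rewrite Rmin_left; [easy|lra].
  - rewrite Rmin_left, Rmax_right by lra. intros x Hx. apply continuity_pt_filterlim.
    apply (continuous_minus (fun x => w1 (Rmin x T)) G).
    + apply (continuous_comp_Rmin w1 (fun x => 0 < x <= T)); [|apply Hmin; lra].
      intros y Hy. apply cont_deriv with (d := w2). now apply Hw2.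
    + apply @ex_derive_continuous. eexists. apply DG. lra.
  - cbv beta in Hc. rewrite Rmin_left in Hc by lra. rewrite (Rmin_left s) in Hc by lra.
    assert (G T = w1 T). { unfold G. rewrite (RInt_point (V := R_CompleteNormedModule)). apply Rplus_0_r. }
    lra. }
set (g s := if Rle_dec s 0 then du0 else G s).
assert (gpos : forall s, 0 < s -> g s = G s) by (intros s Hs; unfold g; destruct (Rle_dec s 0); lra).
assert (gneg : forall s, s <= 0 -> g s = du0) by (intros s Hs; unfold g; destruct (Rle_dec s 0); lra).
assert (Dg : forall s, 0 < s -> is_derive g s (dg s)).
{ intros s Hs. apply (is_derive_ext_loc G); [|auto].
  generalize (open_gt 0 s Hs). apply filter_imp. intros y Hy. symmetry; auto. }
exists g, dg. split; [split; [|split]|split]; auto.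
- intro x. destruct (Rtotal_order x 0) as [Hx|[->|Hx]].
  + apply (continuous_ext_loc _ (fun _ => du0)); [|apply continuous_const].
    generalize (open_lt 0 x Hx). apply filter_imp. intros y Hy. symmetry; apply gneg. lra.
  + apply continuity_pt_filterlim. intros eps Heps.
    (* The two pieces of g join at 0 because u' is continuous on [0, T]; capping the radius by T
       keeps y where g = u'. *)
    destruct (Cu1 0 ltac:(lra) eps Heps) as [a [Ha H]].
    exists (Rmin a T). split; [apply Rmin_pos; lra|].
    intros y [_ Hy]. simpl in *. unfold R_dist in *. rewrite (gneg 0) by lra. rewrite Rminus_0_r in Hy.
    destruct (Rle_lt_dec y 0). { rewrite gneg, Rminus_diag, Rabs_R0; lra. }
    assert (Rabs y < a) by (eapply Rlt_le_trans; [exact Hy|apply Rmin_l]).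
    assert (Rabs y < T) by (eapply Rlt_le_trans; [exact Hy|apply Rmin_r]).
    rewrite Rabs_pos_eq in H1, H2 by lra.
    rewrite gpos, EG, E1 by lra. rewrite <- E0. apply H.
    split; [split; lra|]. rewrite Rminus_0_r, Rabs_pos_eq; lra.
  + apply @ex_derive_continuous. eexists. now apply Dg.
- intros s Hs. rewrite gpos, EG by lra. auto.
- apply gneg. lra.
Qed.

Theorem lemma2p1 (T alpha : R) (u : R -> R) (du0 : R)
  (hT : 0 < T)
  (halpha : 1 < alpha < 2)
  (hC1 : C_class 1 (fun x => 0 <= x <= T) u)
  (hC2 : C_class 2 (fun x => 0 < x <= T) u)
  (* du0 is u'(0), the derivative of u on [0, T] at the end point 0 *)
  (hdu0 : D_in u (fun _ => du0) (fun x => 0 <= x <= T) 0) :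
  let bu := fun s : R => u s - s * du0 in
  forall t : R, 0 < t <= T ->
    (ex_Caputo alpha u t /\
     ex_Caputo (alpha / 2) u t /\
     ex_Caputo (alpha / 2) (Caputo (alpha / 2) u) t /\
     Caputo alpha u t
       = Caputo (alpha / 2) (Caputo (alpha / 2) u) t
         - du0 * omega (2 - alpha) t)
    /\
    (ex_Caputo alpha bu t /\
     ex_Caputo (alpha / 2) bu t /\
     ex_Caputo (alpha / 2) (Caputo (alpha / 2) bu) t /\
     Caputo alpha u t = Caputo alpha bu t /\
     Caputo alpha bu t = Caputo (alpha / 2) (Caputo (alpha / 2) bu) t).
Proof.
intros bu t Ht.
destruct (C1_pos_extension T du0 u hT hC1 hC2 hdu0) as (g & dg & Hg & Hu & Hg0).
destruct (Caputo_split T alpha u g dg halpha Hg Hu t Ht) as (A1 & A2 & A3 & A4 & A5).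
(* Subtracting s u'(0) shifts g by a constant and keeps dg: A4 and B4 then have the same right-hand
   side, and in B5 the coefficient of omega becomes du0 - du0. *)
destruct (Caputo_split T alpha bu (fun s => g s - du0) dg halpha) with (t := t) as (B1 & B2 & B3 & B4 & B5); auto.
- now apply C1_pos_sub_const.
- intros s Hs. apply (is_derive_minus (V := R_NormedModule) u (fun s => s * du0)); auto.
  auto_derive; [easy|ring].
- rewrite Hg0 in A5, B5.
  repeat split; auto; try apply A1; try apply A2; try apply A3; try apply B1; try apply B2; try apply B3.
  + now rewrite A4, B4.
  + rewrite B5. ring.
Qed.
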